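(* There are absolute constants $A,B>0$ such that for every integer $n\geq 1$, if $(u,v)$ is chosen uniformly at random from $B_n\times B_n$, then $$\mathbb P_{(u,v)\in B_n\times B_n}\bigl(\varphi_{u,v}\text{ is not prime}\bigr)\leq A\,n^B\,3^{-n/14}.$$ Consequently, $\delta_{\mathrm{np}}\leq \frac{27}{28}$.
   Context: $F_2=F(a,b)$ is the free group of rank two with fixed basis $(a,b)$, and $B_n\subset F_2$ is the ball of radius $n$ in the word metric with respect to $\{a,b\}$ (elements of reduced word length at most $n$), so $|B_n|=2\cdot 3^n-1$. For $u,v\in F_2$, $\varphi_{u,v}\colon F_2\to F_2$ is the endomorphism with $a\mapsto u$, $b\mapsto v$. An endomorphism $\varphi\colon F_2\to F_2$ is called prime if it is injective and, whenever $\varphi=\alpha\circ\beta$ with endomorphisms $\alpha,\beta\colon F_2\to F_2$, at least one of $\alpha,\beta$ is an automorphism. (In particular non-injective endomorphisms are not prime.) Let $\mathcal N_n=\{(u,v)\in B_n\times B_n:\varphi_{u,v}\text{ is not prime}\}$ and $$\delta_{\mathrm{np}}=\limsup_{n\to\infty}\frac{\log|\mathcal N_n|}{\log|B_n\times B_n|}.$$ *)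

(* Defs.v *)
From HB Require Import structures.
From mathcomp Require Import all_boot all_order all_algebra.
From mathcomp Require Import finmap.
From mathcomp Require Import all_classical all_reals all_analysis.

Set Implicit Arguments.
Unset Strict Implicit.
Unset Printing Implicit Defensive.

Import Order.TTheory GRing.Theory Num.Theory.

Local Open Scope group_scope.

(* [(i, s)] stands for a ([i = false]) or b ([i = true]), inverted if [s]. *)
Notation letter := (bool * bool)%type.

Definition linv (l : letter) : letter := (l.1, ~~ l.2).

Definition reduced (w : seq letter) : bool :=
  sorted (fun x y => y != linv x) w.

(* Left multiplication of a reduced word by a letter. *)
Definition lcons (l : letter) (w : seq letter) : seq letter :=
  if w is l' :: w' then if l' == linv l then w' else l :: w else [:: l].

Definition reduce (w : seq letter) : seq letter := foldr lcons [::] w.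

Definition winv (w : seq letter) : seq letter := rev (map linv w).

Lemma linvK : involutive linv.
Proof. by case=> i s; rewrite /linv /= negbK. Qed.

Lemma reduced_lcons l w : reduced w -> reduced (lcons l w).
Proof.
case: w => [|l' w] //= rw; case: ifP => [_|/negbT ne].
  exact: path_sorted rw.
by rewrite /= ne.
Qed.

Lemma reduced_foldr s w : reduced w -> reduced (foldr lcons w s).
Proof. by elim: s => //= l s IHs /IHs; apply: reduced_lcons. Qed.

Lemma reduced_reduce w : reduced (reduce w).
Proof. exact: reduced_foldr. Qed.

Lemma lconsK l w : reduced w -> lcons (linv l) (lcons l w) = w.
Proof.
case: w => [|l' w] /= rw; first by rewrite linvK eqxx.
case: eqP rw => [-> | _ _] /=; last by rewrite linvK eqxx.
by case: w => [|l'' w] //= /andP[/negPf ->].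
Qed.

Lemma foldr_reduced s : reduced s -> foldr lcons [::] s = s.
Proof.
elim: s => //= l s IHs rs; rewrite IHs; last exact: path_sorted rs.
by case: s rs {IHs} => //= l' s /andP[/negPf ->].
Qed.

Lemma foldr_reduce s w :
  reduced w -> foldr lcons w (reduce s) = foldr lcons w s.
Proof.
move=> rw; elim: s => //= l s <-.
case: (reduce s) => [|l' r] //=; case: eqP => [->|//].
by rewrite -{1}(linvK l) lconsK // reduced_foldr.
Qed.

Lemma winvK : involutive winv.
Proof. by move=> w; rewrite /winv map_rev revK mapK //; apply: linvK. Qed.

Lemma reduced_winv w : reduced w -> reduced (winv w).
Proof.
rewrite /reduced /winv rev_sorted sorted_map; apply: sub_sorted => x y /=.
by apply: contra => /eqP/(can_inj linvK) ->; rewrite linvK.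
Qed.

Lemma foldr_winv s w :
  reduced w -> foldr lcons (foldr lcons w s) (winv s) = w.
Proof.
move=> rw; elim: s => //= l s IHs; rewrite /winv /= rev_cons foldr_rcons.
by rewrite lconsK ?IHs // reduced_foldr.
Qed.

Record F2 := FreeWord { fword :> seq letter; fword_reduced : reduced fword }.

HB.instance Definition _ := [isSub for fword].
HB.instance Definition _ := [Countable of F2 by <:].

Lemma fword_inj : injective fword. Proof. exact: val_inj. Qed.

Definition f2_one : F2 := @FreeWord [::] isT.
Definition f2_mul (x y : F2) : F2 := FreeWord (reduced_reduce (x ++ y)).
Definition f2_inv (x : F2) : F2 := FreeWord (reduced_winv (fword_reduced x)).

Lemma f2_mulE (x y : F2) : f2_mul x y = foldr lcons y x :> seq letter.
Proof. by rewrite /= /reduce foldr_cat foldr_reduced ?fword_reduced. Qed.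

Lemma f2_mulA : associative f2_mul.
Proof.
move=> x y z; apply: fword_inj; rewrite f2_mulE (f2_mulE y) (f2_mulE _ z).
by rewrite /= foldr_reduce ?fword_reduced // foldr_cat.
Qed.

Lemma f2_mul1g : left_id f2_one f2_mul.
Proof. by move=> x; apply: fword_inj; rewrite f2_mulE. Qed.

Lemma f2_mulg1 : right_id f2_one f2_mul.
Proof.
move=> x; apply: fword_inj; rewrite f2_mulE.
by rewrite foldr_reduced ?fword_reduced.
Qed.

Lemma f2_mulVg : left_inverse f2_one f2_inv f2_mul.
Proof.
move=> x; apply: fword_inj; rewrite f2_mulE /=.
by rewrite -{1}(foldr_reduced (fword_reduced x)) foldr_winv.
Qed.

Lemma f2_mulgV : right_inverse f2_one f2_inv f2_mul.
Proof.
move=> x; rewrite -{1}(_ : f2_inv (f2_inv x) = x) ?f2_mulVg //.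
by apply: fword_inj; rewrite /= winvK.
Qed.

HB.instance Definition _ :=
  isGroup.Build F2 f2_mulA f2_mul1g f2_mulg1 f2_mulVg f2_mulgV.

Lemma fwordM (x y : F2) : x * y = foldr lcons y x :> seq letter.
Proof. exact: f2_mulE. Qed.

Definition gen_a : F2 := @FreeWord [:: (false, false)] isT.
Definition gen_b : F2 := @FreeWord [:: (true, false)] isT.

Definition wball (n : nat) : set F2 := [set g : F2 | size g <= n].

Notation endF2 := (UMagmaMorphism.type F2 F2).

Definition letter_image (u v : F2) (l : letter) : F2 :=
  let g := if l.1 then v else u in if l.2 then g^-1 else g.

(* The endomorphism sending a to [u] and b to [v]; see [phi_gen_a],
   [phi_gen_b] and [phi_unique]. *)
Definition phi (u v : F2) (w : F2) : F2 := \prod_(l <- w) letter_image u v l.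

Lemma letter_image_linv u v l :
  letter_image u v (linv l) = (letter_image u v l)^-1.
Proof. by case: l => i [] /=; rewrite /letter_image /= ?invgK. Qed.

Lemma phi_morphism u v : monoid.monoid_morphism (phi u v).
Proof.
split=> [|x y]; first by rewrite /phi big_nil.
rewrite /phi fwordM.
elim: (fword x) => [|l s IHs] /=; first by rewrite big_nil mul1g.
rewrite big_cons -mulgA -{}IHs; case: (foldr _ _ _) => [|l' r] /=.
  by rewrite big_seq1 big_nil mulg1.
case: eqP => [->|_]; rewrite !big_cons //.
by rewrite letter_image_linv mulVKg.
Qed.

HB.instance Definition _ u v :=
  isUMagmaMorphism.Build F2 F2 (phi u v) (phi_morphism u v).

Lemma phi_gen_a u v : phi u v gen_a = u.
Proof. by rewrite /phi big_seq1. Qed.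

Lemma phi_gen_b u v : phi u v gen_b = v.
Proof. by rewrite /phi big_seq1. Qed.

Lemma phi_unique (f : endF2) : f =1 phi (f gen_a) (f gen_b).
Proof.
case=> w rw; elim: w rw => [|l w IHw] rw.
  rewrite (_ : FreeWord rw = 1); last exact: val_inj.
  by rewrite !gmulf1.
have rl : reduced [:: l] by [].
have rw' : reduced w by exact: path_sorted rw.
have -> : FreeWord rw = FreeWord rl * FreeWord rw'.
  apply: fword_inj; rewrite fwordM.
  have := foldr_reduced rw.
  by rewrite /= (foldr_reduced rw').
rewrite !gmulfM IHw; congr (_ * _).
rewrite /= /phi /= big_seq1.
case: l rl {rw} => [[] []] rl; rewrite /letter_image /= -?gmulfV;
  by congr (f _); apply: fword_inj.
Qed.

Definition prime_endo (f : endF2) : Prop :=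
  injective f /\
  forall al be : endF2, f =1 al \o be -> bijective al \/ bijective be.

(* [fset_set A] is the finite set underlying [A], and is empty if [A] is
   infinite; by [finite_wball] it is only used on finite sets here. *)
Definition cardF (T : choiceType) (A : set T) : nat := #|` fset_set A|%fset.

Lemma finite_wball n : finite_set (wball n).
Proof.
pose s := flatten [seq [seq val t | t : k.-tuple letter] | k <- iota 0 n.+1].
apply: (@sub_finite_set _ _ [set x | x \in pmap insub s]); last first.
  exact: finite_seq.
move=> x; rewrite /wball /= => xn; rewrite mem_pmap.
apply/mapP; exists (fword x); last by rewrite valK.
apply/flatten_mapP; exists (size x); first by rewrite mem_iota.
by apply/mapP; exists (in_tuple x); rewrite ?mem_enum.
Qed.

Lemma finite_wball_pair n : finite_set (wball n `*` wball n)%classic.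
Proof. by apply: finite_setX; apply: finite_wball. Qed.

Local Open Scope ring_scope.

(* The probability of [E] under the uniform law on the finite set [A]. *)
Definition unif_prob (R : realType) (T : choiceType) (A E : set T) : R :=
  (cardF (A `&` E)%classic)%:R / (cardF A)%:R.

Definition Nnp (n : nat) : set (F2 * F2) :=
  ((wball n `*` wball n) `&` [set p | ~ prime_endo (phi p.1 p.2)])%classic.

(* At n = 0 the quotient is the junk value 0 / 0 = 0, which does not affect
   the limsup. *)
Definition delta_np (R : realType) : \bar R :=
  limn_esup (fun n : nat =>
    (ln (cardF (Nnp n))%:R
       / ln (cardF (wball n `*` wball n)%classic)%:R : R)%:E).

(* Main.v *)
(* If phi factors as alpha o beta with neither factor an automorphism, then u, v
   lie in K, the image of alpha, which is carried by a labelled graph of rank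
   two.  Up to an automorphism of F(a, b) and a conjugation by g, such a graph
   consists of two vertices joined by an edge wr, together with two more edges
   wa, wb: a theta graph, a barbell, or, when wr is trivial, a wedge of two
   circles.  Taking the total length minimal, and then g minimal, makes reading
   along reduced paths cancellation free.

   Let m = n / 14 and suppose that no word of length > m occurs twice, even up
   to inversion, in u and v; this fails with probability O(n^2 3^(-n/14)).
   If the paths of u and v together traverse wa (or wb) at most once, then beta
   is an automorphism, or u or v is a proper power, or u and v coincide up to
   inversion; the last two cases are rare.  Otherwise each edge is traversed
   twice, which bounds wa, wb, wr and g by 2m, so that there are few graphs.  In
   each of them there are few pairs of paths: O(n 2^n) paths of length n when wr
   is nontrivial, and O(n (9/4)^n) in a wedge of two circles, one of which has
   length at least 2 because alpha is not an automorphism.  The estimates close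
   because 4 * 3^(8/14) and (9/4)^2 * 3^(6/14) are at most 3^(27/14). *)
Require Import Defs.
From mathcomp Require Import all_boot all_order all_algebra.
From mathcomp Require Import zify ring lra finmap.
From mathcomp Require Import all_classical all_reals all_analysis.
Set Implicit Arguments.
Unset Strict Implicit.
Unset Printing Implicit Defensive.
Import Order.TTheory GRing.Theory Num.Theory.
Local Open Scope group_scope.

(** * Words and cancellation *)

(** Cancellation has two sources. Inside the graph it is excluded by minimality, since each way of
    losing letters at a vertex is a move that lowers the weight. At the base point it comes from the
    conjugator [g], and there minimality only ensures that an edge loses at most half of its label.
    So edges are replaced by their surviving cores, and a bound m on repeated cores becomes 2m for
    labels. Likewise what is left of [g] after m letters occurs, together with its inverse, at the
    two ends of u, which bounds [g] by 2m.

    A trivial loop in the graph makes the image cyclic and the pair exceptional. Applied to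
    [phi u v] itself, this alternative shows that all other pairs give injective maps, so that
    failing to be prime then means having a factorization.

    The value 14 balances the saving 3^(-m) from repetitions against the number of graphs, of order
    3^(8m) in general and 3^(6m) for wedges. With the growth bound 9/4 the wedges are the tight
    case: there 13 in place of 14 would fail. *)

Lemma linv_neq l : linv l != l.
Proof. by case: l => [[] []]. Qed.

Lemma winv_cat s t : winv (s ++ t) = winv t ++ winv s.
Proof. by rewrite /winv map_cat rev_cat. Qed.

Lemma size_winv s : size (winv s) = size s.
Proof. by rewrite /winv size_rev size_map. Qed.

Lemma winv_cons l s : winv (l :: s) = rcons (winv s) (linv l).
Proof. by rewrite /winv /= rev_cons. Qed.

Lemma winv_take k s : winv (take k s) = drop (size s - k) (winv s).
Proof.
rewrite /winv map_take drop_rev size_map; case: (leqP k (size s)) => h.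
  by rewrite subKn.
by rewrite !take_oversize ?size_map //; lia.
Qed.

Lemma winv_drop k s : winv (drop k s) = take (size s - k) (winv s).
Proof.
rewrite -{3}(cat_take_drop k s) winv_cat take_size_cat // size_winv.
by rewrite size_drop.
Qed.

(** No cancellation at the seam of [s ++ t]. The last letter of [s] is read as the head of [winv s],
    which makes the condition symmetric under inversion. *)
Definition junction (s t : seq letter) : bool :=
  [|| s == [::], t == [::] | ohead (winv s) != ohead t].

Lemma ohead_winv_rcons s x : ohead (winv (rcons s x)) = Some (linv x).
Proof. by rewrite -cats1 winv_cat. Qed.

Lemma reduced_cat s t :
  reduced (s ++ t) = [&& reduced s, reduced t & junction s t].
Proof.
case: s => [|x s]; first by rewrite /= /junction eqxx andbT.
case: t => [|y t]; first by rewrite cats0 /= andbT.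
rewrite /reduced /= cat_path /=; congr andb.
rewrite andbC; congr andb; rewrite /junction /=.
have -> : ohead (winv (x :: s)) = Some (linv (last x s)).
  by rewrite lastI ohead_winv_rcons.
by rewrite eq_sym.
Qed.

Lemma reduced_catl s t : reduced (s ++ t) -> reduced s.
Proof. by rewrite reduced_cat => /and3P[]. Qed.

Lemma reduced_catr s t : reduced (s ++ t) -> reduced t.
Proof. by rewrite reduced_cat => /and3P[]. Qed.

Lemma reduced_winvE s : reduced (winv s) = reduced s.
Proof. by apply/idP/idP => /reduced_winv; rewrite ?winvK. Qed.

Lemma reduced_cons l s : reduced (l :: s) = reduced s && (ohead s != Some (linv l)).
Proof.
rewrite -cat1s reduced_cat /junction /=; congr andb.
by case: s => //= x s; rewrite eq_sym.
Qed.

Definition elt (s : seq letter) : F2 := FreeWord (reduced_reduce s).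

Lemma fword_elt s : reduced s -> elt s = s :> seq letter.
Proof. by move=> rs; rewrite /= /reduce foldr_reduced. Qed.

Lemma eltK (x : F2) : elt x = x.
Proof. by apply: fword_inj; rewrite fword_elt ?fword_reduced. Qed.

Lemma elt_cat s t : elt (s ++ t) = elt s * elt t.
Proof.
apply: fword_inj; rewrite fwordM /= foldr_reduce ?reduced_reduce //.
by rewrite /reduce foldr_cat.
Qed.

Lemma elt_nil : elt [::] = 1.
Proof. by apply: fword_inj. Qed.

Lemma fword1 : fword 1 = [::]. Proof. by []. Qed.

Lemma fwordV (x : F2) : fword x^-1 = winv x. Proof. by []. Qed.

Lemma elt_winv s : elt (winv s) = (elt s)^-1.
Proof.
elim: s => [|l s IHs]; first by rewrite elt_nil invg1.
rewrite winv_cons -cats1 elt_cat IHs (elt_cat [:: l]) invgM; congr (_ * _).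
exact: fword_inj.
Qed.

Lemma fwordM_cat (x y : F2) : reduced (x ++ y) -> fword (x * y) = x ++ y.
Proof. by move=> rxy; rewrite -{1}(eltK x) -{1}(eltK y) -elt_cat fword_elt. Qed.

Lemma fword_eq1 (x : F2) : (x == 1) = (fword x == [::]).
Proof. by []. Qed.

Lemma size_fword_eq0 (x : F2) : (size x == 0)%N = (x == 1).
Proof. by rewrite size_eq0. Qed.

Lemma size_fword_gt0 (x : F2) : (0 < size x)%N = (x != 1).
Proof. by rewrite lt0n size_fword_eq0. Qed.

Lemma size_fwordV x : size (x^-1 : F2) = size x.
Proof. by rewrite fwordV size_winv. Qed.

(** For reduced words this is the number of letters of each factor that cancel in [x^-1 * y]. *)
Fixpoint lcp (s t : seq letter) : nat :=
  if s is x :: s' then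
    if t is y :: t' then if x == y then (lcp s' t').+1 else 0 else 0
  else 0.

Lemma lcpC s t : lcp s t = lcp t s.
Proof. by elim: s t => [|x s IHs] [|y t] //=; rewrite eq_sym; case: eqP => // _; rewrite IHs. Qed.

Lemma lcp_sizel s t : lcp s t <= size s.
Proof. by elim: s t => [|x s IHs] [|y t] //=; case: eqP => // _; apply: IHs. Qed.

Lemma lcp_sizer s t : lcp s t <= size t.
Proof. by rewrite lcpC lcp_sizel. Qed.

Lemma lcp_take s t : take (lcp s t) s = take (lcp s t) t.
Proof. by elim: s t => [|x s IHs] [|y t] //=; case: eqP => //= -> ; rewrite IHs. Qed.

Lemma lcp_drop s t : junction (winv (drop (lcp s t) s)) (drop (lcp s t) t).
Proof.
elim: s t => [|x s IHs] [|y t] //=; rewrite ?/junction ?eqxx ?orbT //.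
case: ifP => [_|/negbT ne]; first exact: IHs.
by rewrite !drop0 winvK /=; apply/orP; right; apply: contra ne => /eqP[->].
Qed.

Lemma lcp_eq0 s t : ohead s != ohead t -> lcp s t = 0.
Proof. by case: s t => [|x s] [|y t] //=; case: (x =P y) => // ->; rewrite eqxx. Qed.

Lemma lcp_catr s t t' : lcp s t < size t -> lcp s (t ++ t') = lcp s t.
Proof. by elim: s t => [|x s IHs] [|y t] //=; case: eqP => // _; rewrite ltnS => /IHs ->. Qed.

Lemma winv_nil s : (winv s == [::]) = (s == [::]).
Proof. by rewrite -!size_eq0 size_winv. Qed.

Lemma fwordVM (x y : F2) :
  fword (x^-1 * y) = winv (drop (lcp x y) x) ++ drop (lcp x y) y.
Proof.
have splitE k (z : F2) : z = elt (take k z) * elt (drop k z).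
  by rewrite -elt_cat cat_take_drop eltK.
have E : x^-1 * y = elt (winv (drop (lcp x y) x) ++ drop (lcp x y) y).
  rewrite elt_cat elt_winv; move: (lcp x y) (lcp_take x y) => k tk.
  by rewrite {1}(splitE k x) {1}(splitE k y) tk invgM -mulgA mulKg.
rewrite E fword_elt // reduced_cat lcp_drop andbT reduced_winvE.
have := fword_reduced x; rewrite -{1}(cat_take_drop (lcp x y) x).
have := fword_reduced y; rewrite -{1}(cat_take_drop (lcp x y) y).
by move=> /reduced_catr -> /reduced_catr ->.
Qed.

Lemma size_fwordVM (x y : F2) : size (x^-1 * y) + 2 * lcp x y = size x + size y.
Proof.
rewrite fwordVM size_cat size_winv !size_drop.
by have := lcp_sizel x y; have := lcp_sizer x y; lia.
Qed.

Lemma size_fwordM (x y : F2) : size (x * y) <= size x + size y.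
Proof. by rewrite -{1}(invgK x) -(size_fwordV x) -size_fwordVM leq_addr. Qed.

Definition lett (l : letter) : F2 := @FreeWord [:: l] isT.

Lemma elt_seq1 l : elt [:: l] = lett l. Proof. exact: fword_inj. Qed.

Lemma lettV l : (lett l)^-1 = lett (linv l). Proof. exact: fword_inj. Qed.

Lemma size_lettV_head l (x : F2) :
  ohead x = Some l -> (size ((lett l)^-1 * x)).+1 = size x.
Proof.
move=> h; have := size_fwordVM (lett l) x; case: (fword x) h => [|y s] //= [->].
by rewrite eqxx /=; lia.
Qed.

Lemma size_conj_head l (x : F2) :
  ohead x = Some l -> ohead x^-1 = Some l ->
  (size ((lett l)^-1 * x * lett l)).+2 = size x.
Proof.
move=> h h'; have s1 := size_lettV_head h.
have E : (lett l)^-1 * x * lett l = ((lett l)^-1 * ((lett l)^-1 * x)^-1)^-1.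
  by rewrite !invgM !invgK.
rewrite E size_fwordV -[in RHS]s1; congr _.+1.
rewrite -(size_fwordV ((lett l)^-1 * x)); apply: size_lettV_head.
have rw : fword x = l :: fword ((lett l)^-1 * x).
  rewrite fwordVM; case: (fword x) h => [|y s] //= [->].
  by rewrite eqxx /= drop0.
case E2 : (fword ((lett l)^-1 * x)) rw => [|y s] rw.
  (* A one-letter word cannot begin with [l] and end with the inverse of [l]. *)
  by move: h'; rewrite fwordV rw => -[/esym/eqP]; rewrite eq_sym (negPf (linv_neq _)).
rewrite fwordV E2; move: h'; rewrite fwordV rw.
by rewrite winv_cons; case: (winv _) (winv_nil (y :: s)).
Qed.

(** * Labelled graphs of rank two *)

Lemma gen_aE : gen_a = lett (false, false). Proof. exact: fword_inj. Qed.
Lemma gen_bE : gen_b = lett (true, false). Proof. exact: fword_inj. Qed.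

Lemma phi_lett u v l : phi u v (lett l) = letter_image u v l.
Proof. by rewrite /phi big_seq1. Qed.

Lemma phi_elt u v s : phi u v (elt s) = \prod_(l <- s) letter_image u v l.
Proof.
elim: s => [|l s IHs]; first by rewrite elt_nil gmulf1 big_nil.
by rewrite (elt_cat [:: l]) gmulfM /= IHs elt_seq1 phi_lett big_cons.
Qed.

Lemma letter_image_morph (f : endF2) u v l :
  f (letter_image u v l) = letter_image (f u) (f v) l.
Proof. by case: l => [[] []]; rewrite /letter_image /= ?gmulfV. Qed.

Lemma phi_comp (f : endF2) u v w : f (phi u v w) = phi (f u) (f v) w.
Proof.
by rewrite /phi gmulf_prod; apply: eq_bigr => l _; apply: letter_image_morph.
Qed.

Lemma phi_id w : phi gen_a gen_b w = w.
Proof. by have := phi_unique (idfun : endF2) w. Qed.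

Lemma phi_conj u v h w : phi (u ^ h) (v ^ h) w = (phi u v w) ^ h.
Proof.
rewrite /phi conjg_prod; apply: eq_bigr => l _.
by case: l => [[] []]; rewrite /letter_image /= ?conjVg.
Qed.

Lemma conjg_bij (h : F2) : bijective (fun x : F2 => x ^ h).
Proof. by exists (fun x => x ^ h^-1) => x; rewrite ?conjgK ?conjgKV. Qed.

(* A labelled graph of rank two with vertices [false] (the base point) and
   [true]: an edge labelled [wr] from [false] to [true], and for every letter
   [z] a directed edge labelled [letter_image wa wb z] from [sd z] to
   [sd (linv z)].  Contracting the edge [wr] identifies its fundamental group
   with F(a, b). *)
Record lgraph := LGraph { wa : F2; wb : F2; wr : F2; sd : {ffun letter -> bool} }.

Definition edge (S : lgraph) (z : letter) : F2 := letter_image (wa S) (wb S) z.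

Definition conn (S : lgraph) (p q : bool) : F2 :=
  if p == q then 1 else if q then wr S else (wr S)^-1.

Definition loop (S : lgraph) (z : letter) : F2 :=
  conn S false (sd S z) * edge S z * conn S (sd S (linv z)) false.

Definition mor (S : lgraph) : F2 -> F2 :=
  phi (loop S (false, false)) (loop S (true, false)).

(* Each vertex carries two of the four ends of the edges [a], [b]. *)
Definition balanced (s : letter -> bool) : bool :=
  (s (false, false) + s (false, true) + s (true, false) + s (true, true) == 2)%N.

(** The coefficients satisfy 2 < 3 < 2 + 2. A fold lengthens [wr] by one letter and removes two
    letters from the other edges, so 3 < 4 is needed; exchanging [wr] with a shorter edge gains
    because 2 < 3. *)
Definition weight (S : lgraph) : nat :=
  2 * size (wa S) + 2 * size (wb S) + 3 * size (wr S).

(* Up to conjugation by [g], [f] is induced by [S] through the change of basis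
   [phi P Q]. *)
Definition rep (f : F2 -> F2) (S : lgraph) (P Q g : F2) : Prop :=
  bijective (phi P Q) /\ forall w, f w = (mor S (phi P Q w)) ^ g.

Lemma edgeV S z : edge S (linv z) = (edge S z)^-1.
Proof. exact: letter_image_linv. Qed.

Lemma connV S p q : (conn S p q)^-1 = conn S q p.
Proof. by case: p q => [] []; rewrite /conn /= ?invg1 ?invgK. Qed.

Lemma connM S p q t : conn S p q * conn S q t = conn S p t.
Proof.
by case: p q t => [] [] []; rewrite /conn /= ?mulg1 ?mul1g ?mulVg ?mulgV.
Qed.

Lemma conn_wr1 S p q : wr S = 1 -> conn S p q = 1.
Proof. by rewrite /conn => ->; rewrite invg1; case: p q => [] []. Qed.

Lemma loopV S z : loop S (linv z) = (loop S z)^-1.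
Proof. by rewrite /loop linvK edgeV !invgM !connV mulgA. Qed.

Lemma letter_image_loop S z :
  letter_image (loop S (false, false)) (loop S (true, false)) z = loop S z.
Proof.
by case: z => [[] []] //; rewrite /letter_image /= -loopV.
Qed.

Lemma mor_lett S z : mor S (lett z) = loop S z.
Proof. by rewrite /mor phi_lett letter_image_loop. Qed.

Lemma size_edgeV S z : size (edge S (linv z)) = size (edge S z).
Proof. by rewrite edgeV size_fwordV. Qed.

Lemma weightE S z z' : z.1 != z'.1 ->
  weight S = 2 * size (edge S z) + 2 * size (edge S z') + 3 * size (wr S).
Proof.
by case: z z' => [[] []] [[] []] // _;
  rewrite /weight /edge /letter_image /= ?size_fwordV // ?size_winv; lia.
Qed.

Lemma mor_ext S S' : (forall z, loop S z = loop S' z) -> mor S =1 mor S'.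
Proof. by move=> e w; rewrite /mor !e. Qed.

Lemma rep_ext f S S' P Q g : (forall z, loop S z = loop S' z) ->
  rep f S P Q g -> rep f S' P Q g.
Proof. by move=> /mor_ext e [bij fE]; split=> // w; rewrite fE e. Qed.

(** Slides the vertex [true] along [h] without changing the label of any loop. With [h] a common
    first letter of two edges leaving [true] this is a Stallings fold. *)
Definition gauge (S : lgraph) (h : F2) : lgraph :=
  let c p := if p then h else 1 in
  LGraph ((c (sd S (false, false)))^-1 * wa S * c (sd S (false, true)))
        ((c (sd S (true, false)))^-1 * wb S * c (sd S (true, true)))
        (wr S * h) (sd S).

Lemma edge_gauge S h z : edge (gauge S h) z =
  (if sd S z then h else 1)^-1 * edge S z * (if sd S (linv z) then h else 1).
Proof.
by case: z => [[] []]; rewrite /edge /letter_image //= !invgM ?invgK ?mulgA.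
Qed.

Lemma loop_gauge S h z : loop S z = loop (gauge S h) z.
Proof.
rewrite /loop edge_gauge /=.
by rewrite /conn; case: (sd S z); case: (sd S (linv z)) => /=;
  rewrite ?invg1 ?mul1g ?mulg1 ?invgM ?mulgA ?mulgK.
Qed.

(** Moves the base point across [wr]; loops get conjugated by [wr], which the conjugator [g]
    compensates. *)
Definition flip (S : lgraph) : lgraph :=
  LGraph (wa S) (wb S) (wr S)^-1 [ffun z => ~~ sd S z].

Lemma weight_flip S : weight (flip S) = weight S.
Proof. by rewrite /weight /= size_winv. Qed.

Lemma loop_flip S z : loop (flip S) z = loop S z ^ wr S.
Proof.
rewrite conjgE /loop /flip /edge /conn /= !ffunE.
by case: (sd S z); case: (sd S (linv z));
  rewrite /= ?invgK ?mul1g ?mulg1 ?mulgA ?mulVg ?mul1g ?mulgVK.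
Qed.

Lemma rep_flip f S P Q g : rep f S P Q g -> rep f (flip S) P Q ((wr S)^-1 * g).
Proof.
move=> [bij fE]; split=> // w.
by rewrite fE /mor !loop_flip phi_conj -conjgM mulgA mulgV mul1g.
Qed.

(** Carrying the base point around a loop is an inner automorphism, absorbed by the change of basis;
    it allows [g] to be shortened by a loop label. *)
Lemma rep_loop f S P Q g z : rep f S P Q g ->
  rep f S (P ^ lett z) (Q ^ lett z) ((loop S z)^-1 * g).
Proof.
move=> [bij fE]; split=> [|w].
  apply: (eq_bij (bij_comp (conjg_bij (lett z)) bij)) => w /=.
  by rewrite phi_conj.
rewrite fE phi_conj -mor_lett /mor gmulfJ -conjgM.
by rewrite mulgA mulgV mul1g.
Qed.

Lemma balanced_other (s : letter -> bool) z : balanced s ->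
  exists2 z', z' != z & s z' = s z.
Proof.
rewrite /balanced => bs.
have [z' /andP[] *|n] := pickP [pred z' | (z' != z) && (s z' == s z)].
  by exists z' => //; apply/eqP.
have {}n (z' : letter) : z' != z -> s z' = ~~ s z.
  by move=> ne; have := n z'; rewrite /= ne /=; case: (s z'); case: (s z).
exfalso; move: bs (n (false, false)) (n (false, true)) (n (true, false)) (n (true, true)).
case: z {n} => [[] []]; case: (s (false, false)); case: (s (false, true));
  case: (s (true, false)); case: (s (true, true)) => //=;
  move=> _ n1 n2 n3 n4; first
    [by move: (n1 isT)|by move: (n2 isT)|by move: (n3 isT)|by move: (n4 isT)].
Qed.

Lemma balanced_out (s : letter -> bool) z z' t : balanced s -> z != z' ->
  s z' = s z -> t != z -> t != z' -> s t = ~~ s z.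
Proof.
rewrite /balanced.
case: z => [[] []]; case: z' => [[] []] //; case: t => [[] []] //;
case: (s (false, false)); case: (s (false, true)); case: (s (true, false));
case: (s (true, true)) => //.
Qed.

Lemma linv_eqV z z' : z != z' -> z.1 = z'.1 -> z' = linv z.
Proof. by case: z z' => [[] []] [[] []]. Qed.

Lemma size_lett l : size (lett l) = 1%N. Proof. by []. Qed.

Lemma size_mul_lett (x : F2) l : size (x * lett l) <= (size x).+1.
Proof. by rewrite -addn1 -(size_lett l) size_fwordM. Qed.

Lemma size_lettV_mul (x : F2) l : size ((lett l)^-1 * x) <= (size x).+1.
Proof. by rewrite lettV -add1n -(size_lett (linv l)) size_fwordM. Qed.

Lemma size_mul_lett_head (x : F2) l :
  ohead x^-1 = Some l -> (size (x * lett l)).+1 = size x.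
Proof.
move=> h; rewrite -(size_fwordV x) -(size_lettV_head h) -(size_fwordV (_ * lett l)).
by rewrite invgM.
Qed.

(** The two ends at [true] belong either to a single edge, a closed loop that gets conjugated, or to
    two different edges, each changed at one end only. *)
Lemma weight_gauge S z z' l (lS := gauge S (lett l)) : balanced (sd S) ->
  z != z' -> sd S z -> sd S z' ->
  (if z' == linv z then
     exists2 t, t.1 != z.1 & (size (edge lS t) = size (edge S t))
       /\ size (edge lS z) = size ((lett l)^-1 * edge S z * lett l)
   else [/\ z.1 != z'.1, size (edge lS z) = size ((lett l)^-1 * edge S z)
     & size (edge lS z') = size ((lett l)^-1 * edge S z')]).
Proof.
move=> bs ne sz sz'.
have out t : t != z -> t != z' -> sd S t = false.
  by move=> tz tz'; rewrite (balanced_out bs ne) ?sz ?sz'.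
case: ifP => [/eqP zV|/negbT nV].
  exists (~~ z.1, false); first by case: (z.1).
  rewrite !edge_gauge sz -zV sz'; split=> //.
  have o1 : sd S (~~ z.1, false) = false by apply: out; rewrite ?zV; case: (z) => [[] []].
  have o2 : sd S (linv (~~ z.1, false)) = false by apply: out; rewrite ?zV; case: (z) => [[] []].
  by rewrite o1 o2 invg1 mul1g mulg1.
have ne1 : z.1 != z'.1.
  by apply: contra nV => /eqP /(linv_eqV ne) ->.
split=> //; rewrite !edge_gauge ?sz ?sz'.
  rewrite [sd S (linv z)]out ?mulg1 ?linv_neq //.
  by apply: contra nV => /eqP <-.
rewrite [sd S (linv z')]out ?mulg1 ?linv_neq //.
by apply: contra nV => /eqP <-; rewrite linvK.
Qed.

Lemma weight_fold S z z' l : balanced (sd S) -> z != z' ->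
  sd S z -> sd S z' -> ohead (edge S z) = Some l ->
  ohead (edge S z') = Some l ->
  weight (gauge S (lett l)) < weight S.
Proof.
move=> bs ne sz sz' h h'; have := weight_gauge l bs ne sz sz'.
have := size_mul_lett (wr S) l.
case: ifP => [/eqP zV|_] hr.
  case=> t; rewrite eq_sym => nt [tE zE].
  rewrite (weightE (gauge _ _) nt) (weightE S nt) tE zE /=.
  move: h'; rewrite zV edgeV => h'.
  by have := size_conj_head h h'; move: hr => /=; lia.
case=> nz zE zE'; rewrite (weightE _ nz) (weightE S nz) zE zE'.
have := size_lettV_head h; have := size_lettV_head h'.
by move: hr => /=; lia.
Qed.

Lemma weight_pull S z l : balanced (sd S) -> sd S z ->
  ohead (edge S z) = Some l -> ohead (wr S)^-1 = Some l ->
  weight (gauge S (lett l)) < weight S.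
Proof.
move=> bs sz h h'; have [z' ne sz'] := balanced_other z bs.
rewrite sz in sz'; rewrite eq_sym in ne.
have := weight_gauge l bs ne sz sz'; have hr := size_mul_lett_head h'.
case: ifP => [/eqP zV|_].
  case=> t; rewrite eq_sym => nt [tE zE].
  rewrite (weightE (gauge _ _) nt) (weightE S nt) tE zE /=.
  have := size_mul_lett ((lett l)^-1 * edge S z) l.
  by have := size_lettV_head h; move: hr => /=; lia.
case=> nz zE zE'; rewrite (weightE _ nz) (weightE S nz) zE zE'.
have := size_lettV_head h; have := size_lettV_mul (edge S z') l.
by move: hr => /=; lia.
Qed.

(** * Normal form of an endomorphism *)

Lemma phi_eq u v u' v' z w : z.1 != w.1 ->
  letter_image u v z = letter_image u' v' z ->
  letter_image u v w = letter_image u' v' w -> phi u v =1 phi u' v'.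
Proof.
rewrite /letter_image => nzw e e' t; suff [-> ->] : u = u' /\ v = v' by [].
by case: z w nzw e e' => [[] []] [[] []] //= _ e e'; split;
  do ?[exact: e | exact: e' | exact: (invg_inj e) | exact: (invg_inj e')].
Qed.

Definition signed (b : bool) (x : F2) : F2 := if b then x^-1 else x.

(* When [wr] is longer than another edge [z] joining the two vertices, the two
   trade places; this changes the basis of the fundamental group. *)
Definition exchange (S : lgraph) (z : letter) : lgraph :=
  if z.1 then LGraph (wa S) (signed z.2 (wr S)) (edge S z) (sd S)
  else LGraph (signed z.2 (wr S)) (wb S) (edge S z) (sd S).

Lemma sd_exchange S z : sd (exchange S z) = sd S.
Proof. by rewrite /exchange; case: ifP. Qed.

Lemma edge_exchange S z : edge (exchange S z) z = wr S.
Proof. by case: z => [[] []]; rewrite /edge /letter_image /= ?invgK. Qed.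

Lemma edge_exchange_neq S z w : z.1 != w.1 -> edge (exchange S z) w = edge S w.
Proof. by case: z w => [[] []] [[] []]. Qed.

Lemma wr_exchange S z : wr (exchange S z) = edge S z.
Proof. by rewrite /exchange; case: ifP. Qed.

Lemma rep_exchange f S P Q g z w : z.1 != w.1 ->
  ~~ sd S z -> sd S (linv z) -> ~~ sd S w -> sd S (linv w) ->
  rep f S P Q g -> exists P' Q', rep f (exchange S z) P' Q' g.
Proof.
move=> nzw /negbTE sz szV /negbTE sw swV [bij fE].
(* With [z] as the new connecting edge, the loop of [z] becomes its inverse and the loop of [w] is
   multiplied by that inverse. This substitution is an involution, hence an automorphism. *)
pose p := lett (linv z); pose q := lett w * lett (linv z).
have [A [B [Az Bw]]] : exists A B : F2, letter_image A B z = p /\ letter_image A B w = q.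
  exists (if z.1 then signed w.2 q else signed z.2 p).
  exists (if z.1 then signed z.2 p else signed w.2 q).
  by rewrite /p /q; case: z w nzw {sz szV sw swV p q} => [[] []] [[] []] //= _;
    rewrite /letter_image /signed /= ?invgK.
have AzV : phi A B (lett (linv z)) = lett z.
  by rewrite phi_lett letter_image_linv Az lettV linvK.
have bijAB : bijective (phi A B).
  have inv x : phi A B (phi A B x) = x.
    rewrite phi_comp -[RHS]phi_id; apply: (phi_eq nzw) => /=.
      rewrite -letter_image_morph /= Az AzV.
      by rewrite -[LHS]phi_id phi_lett.
    rewrite -letter_image_morph /= Bw gmulfM /= AzV phi_lett Bw /q -lettV mulgVK.
    by rewrite -[LHS]phi_id phi_lett.
  by exists (phi A B).
exists (phi A B P), (phi A B Q); split.
  by apply: (eq_bij (bij_comp bijAB bij)) => x /=; rewrite phi_comp.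
move=> x; rewrite fE; congr (_ ^ _).
have -> : phi (phi A B P) (phi A B Q) x = phi A B (phi P Q x) by rewrite phi_comp.
move: (phi P Q x) => {}x.
have Lz : loop (exchange S z) z = (loop S z)^-1.
  rewrite /loop edge_exchange sd_exchange sz szV /conn /= wr_exchange.
  by rewrite !invgM invg1 invgK !mul1g mulg1.
have Lw : loop (exchange S z) w = loop S w * (loop S z)^-1.
  rewrite /loop edge_exchange_neq // sd_exchange sw swV sz szV /conn /= wr_exchange.
  by rewrite !invgM invg1 invgK !mul1g mulg1 mulgA mulgVK.
rewrite /mor phi_comp; apply: (phi_eq nzw) => /=.
  rewrite letter_image_loop -letter_image_morph /= Az phi_lett letter_image_loop.
  by rewrite loopV Lz invgK.
rewrite letter_image_loop -letter_image_morph /= Bw gmulfM /= !phi_lett !letter_image_loop.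
by rewrite loopV Lz Lw invgK mulgVK.
Qed.

(** Apart from [good_bal] and [good_edge], each field says that one move is blocked: [good_heads]
    the folds, [good_headr] pulling a letter off [wr], [good_short] the exchange, [good_lcp] and
    [good_lcpr] moving the base point along an edge to shorten [g]. *)
Record good (S : lgraph) (g : F2) : Prop := Good {
  good_bal : balanced (sd S);
  good_edge : forall z, edge S z != 1;
  good_heads : forall z z', z != z' -> (sd S z == sd S z') || (wr S == 1) ->
    ohead (edge S z) != ohead (edge S z');
  good_headr : wr S != 1 -> forall z,
    ohead (edge S z) != ohead (conn S (sd S z) (~~ sd S z));
  good_short : forall z, sd S z != sd S (linv z) -> size (wr S) <= size (edge S z);
  good_lcp : forall z, ~~ sd S z || (wr S == 1) ->
    2 * lcp g (edge S z) <= size (edge S z);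
  good_lcpr : 2 * lcp g (wr S) <= size (wr S) }.

Definition smaller (f : F2 -> F2) (S : lgraph) (g : F2) : Prop :=
  exists S' P' Q' g', [/\ rep f S' P' Q' g', balanced (sd S') &
    weight S' < weight S \/ weight S' = weight S /\ size g' < size g].

Lemma balanced_flip S : balanced (sd S) -> balanced (sd (flip S)).
Proof.
by rewrite /balanced /= !ffunE; case: (sd S _); case: (sd S _); case: (sd S _); case: (sd S _).
Qed.

Lemma rep_gauge f S P Q g h : rep f S P Q g -> rep f (gauge S h) P Q g.
Proof. exact: rep_ext (loop_gauge S h). Qed.

Lemma fold_smaller f S P Q g z z' : rep f S P Q g -> balanced (sd S) ->
  z != z' -> sd S z = sd S z' -> edge S z != 1 ->
  ohead (edge S z) = ohead (edge S z') -> smaller f S g.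
Proof.
move=> r bs ne ss e1 hh.
have [l hl] : exists l, ohead (edge S z) = Some l.
  by move: e1; rewrite fword_eq1; case: (fword _) => //= l s _; exists l.
have hl' : ohead (edge S z') = Some l by rewrite -hh.
case sz : (sd S z); rewrite sz in ss.
  exists (gauge S (lett l)), P, Q, g; split; [exact: rep_gauge | by [] | left].
  by apply: (@weight_fold _ z z').
exists (gauge (flip S) (lett l)), P, Q, ((wr S)^-1 * g); split.
- exact/rep_gauge/rep_flip.
- exact: balanced_flip.
left; rewrite -(weight_flip S); apply: (@weight_fold _ z z') => //=.
- exact: balanced_flip.
- by rewrite ffunE sz.
- by rewrite ffunE -ss.
Qed.

Lemma pull_smaller f S P Q g z : rep f S P Q g -> balanced (sd S) ->
  edge S z != 1 -> ohead (edge S z) = ohead (conn S (sd S z) (~~ sd S z)) ->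
  smaller f S g.
Proof.
move=> r bs e1 hh.
have [l hl] : exists l, ohead (edge S z) = Some l.
  by move: e1; rewrite fword_eq1; case: (fword _) => //= l s _; exists l.
rewrite hl in hh; case sz : (sd S z); rewrite sz in hh.
  exists (gauge S (lett l)), P, Q, g; split; [exact: rep_gauge | by [] | left].
  exact: (@weight_pull _ z).
exists (gauge (flip S) (lett l)), P, Q, ((wr S)^-1 * g); split.
- exact/rep_gauge/rep_flip.
- exact: balanced_flip.
left; rewrite -(weight_flip S); apply: (@weight_pull _ z).
- exact: balanced_flip.
- by rewrite ffunE sz.
- exact: hl.
- by rewrite [(wr _)^-1]invgK hh.
Qed.

(** When [wr] is trivial both vertices are one point, so any two ends may be declared to sit at
    [true]; this makes every pair of ends of a wedge available for folding. *)
Definition regroup (S : lgraph) (z z' : letter) : lgraph :=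
  LGraph (wa S) (wb S) (wr S) [ffun t => (t == z) || (t == z')].

Lemma loop_wr1 S z : wr S = 1 -> loop S z = edge S z.
Proof. by move=> w1; rewrite /loop !conn_wr1 // mul1g mulg1. Qed.

Lemma balanced_regroup S z z' : z != z' -> balanced (sd (regroup S z z')).
Proof. by case: z z' => [[] []] [[] []] //; rewrite /balanced /= !ffunE. Qed.

Lemma regroup_smaller f S P Q g z z' : rep f S P Q g -> wr S = 1 ->
  z != z' -> edge S z != 1 ->
  ohead (edge S z) = ohead (edge S z') -> smaller f S g.
Proof.
move=> r w1 ne e1 hh.
apply: (@fold_smaller f (regroup S z z') P Q g z z') => //.
- by apply: rep_ext r => t; rewrite !loop_wr1.
- exact: balanced_regroup.
- by rewrite !ffunE !eqxx orbT.
Qed.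

(** If one edge joins the two vertices, balance forces the other edge to join them as well: the
    graph is a theta graph. *)
Lemma exchange_smaller f S P Q g z : rep f S P Q g -> balanced (sd S) ->
  ~~ sd S z -> sd S (linv z) -> size (edge S z) < size (wr S) -> smaller f S g.
Proof.
move=> r bs sz szV lt.
have [w ne sw] := balanced_other z bs.
have nzw : z.1 != w.1.
  apply/eqP => e; move: sw; rewrite (linv_eqV _ e) 1?eq_sym // szV.
  by rewrite (negbTE sz).
have swV : sd S (linv w).
  rewrite (balanced_out (z := z) (z' := w)) //; first by rewrite eq_sym.
    by apply: contra nzw => /eqP <-.
  exact: linv_neq.
rewrite -(sw) in sz.
have sz' : ~~ sd S z by rewrite -sw.
have [P' [Q' r']] := rep_exchange nzw sz' szV sz swV r.
exists (exchange S z), P', Q', g; split=> //; first by rewrite sd_exchange.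
left; rewrite (weightE _ nzw) (weightE S nzw) edge_exchange wr_exchange.
by rewrite edge_exchange_neq //; lia.
Qed.

Lemma flip_smaller f S P Q g : rep f S P Q g -> balanced (sd S) ->
  size (wr S) < 2 * lcp g (wr S) -> smaller f S g.
Proof.
move=> r bs lt; exists (flip S), P, Q, ((wr S)^-1 * g); split.
- exact: rep_flip.
- exact: balanced_flip.
right; split; first exact: weight_flip.
by have := size_fwordVM (wr S) g; rewrite lcpC; lia.
Qed.

(** If [g] starts with more than half of an edge, removing that edge from [g] shortens it. When the
    edge ends at the other vertex, the loop also runs through [wr], and flipping the base point
    cancels that part. *)
Lemma slide_smaller f S P Q g z : rep f S P Q g -> balanced (sd S) ->
  ~~ sd S z || (wr S == 1) -> size (edge S z) < 2 * lcp g (edge S z) ->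
  smaller f S g.
Proof.
move=> r bs base lt.
have lt' : size ((edge S z)^-1 * g) < size g.
  by have := size_fwordVM (edge S z) g; rewrite lcpC; lia.
have r' := rep_loop z r.
have LE : loop S z = edge S z * conn S (sd S (linv z)) false.
  rewrite /loop; case/orP: base => [/negbTE ->|/eqP w1]; first by rewrite mul1g.
  by rewrite conn_wr1 // mul1g.
case szV : (sd S (linv z)); rewrite szV in LE; last first.
  exists S; do 3![eexists]; split; [exact: r' | by [] | right; split=> //].
  by rewrite LE mulg1.
exists (flip S); do 3![eexists]; split; [exact: rep_flip r' | exact: balanced_flip | right].
split; first exact: weight_flip.
by rewrite LE invgM connV -[conn S false true]/(wr S) -mulgA mulKg.
Qed.

Lemma rep_step f S P Q g : rep f S P Q g -> balanced (sd S) ->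
  [\/ exists z, loop S z = 1, good S g | smaller f S g].
Proof.
move=> r bs.
have [z /eqP z1|n1] := pickP [pred z | loop S z == 1].
  by apply: Or31; exists z.
have [z /andP[nz lt]|short] :=
  pickP [pred z | (sd S z != sd S (linv z)) && (size (edge S z) < size (wr S))].
  apply: Or33; case sz : (sd S z).
    apply: (@exchange_smaller f S P Q g (linv z)) => //.
    - by rewrite sz in nz; case: (sd S (linv z)) nz.
    - by rewrite linvK.
    - by rewrite size_edgeV.
  apply: (@exchange_smaller f S P Q g z) => //; rewrite ?sz //.
  by move: nz; rewrite sz; case: (sd S (linv z)).
have short' z : sd S z != sd S (linv z) -> size (wr S) <= size (edge S z).
  by move=> nz; have := short z; rewrite /= nz /= => /negbT; rewrite -leqNgt.
(* A trivial edge gives a trivial loop: either it is closed, or [short'] makes [wr] trivial too. *)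
have e1 z : edge S z != 1.
  apply/eqP => ez; have := n1 z; rewrite /= /loop ez mulg1.
  case: (eqVneq (sd S z) (sd S (linv z))) => [->|/short']; first by rewrite connM eqxx.
  rewrite ez leqn0 size_fword_eq0 => /eqP w1.
  by rewrite !conn_wr1 // mulg1 eqxx.
have [z /existsP[z' /and3P[nz base /eqP hh]]|heads] :=
  pickP [pred z | [exists z', [&& z != z', (sd S z == sd S z') || (wr S == 1)
    & ohead (edge S z) == ohead (edge S z')]]].
  apply: Or33; case/orP: base => [/eqP ss|/eqP w1].
    exact: (fold_smaller r bs nz ss).
  exact: (regroup_smaller r w1 nz).
have [/andP[w1 /existsP[z /eqP hh]]|headr] :=
  boolP ((wr S != 1) && [exists z, ohead (edge S z) == ohead (conn S (sd S z) (~~ sd S z))]).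
  by apply: Or33; apply: (pull_smaller r bs (e1 z) hh).
have [z /andP[base lt]|hl] :=
  pickP [pred z | (~~ sd S z || (wr S == 1)) && (size (edge S z) < 2 * lcp g (edge S z))].
  by apply: Or33; apply: (slide_smaller r bs base lt).
have [lt|hr] := ltnP (size (wr S)) (2 * lcp g (wr S)).
  by apply: Or33; apply: flip_smaller r bs lt.
apply: Or32; split=> //.
- move=> z z' nz base; apply/negP => hh.
  by have := heads z => /existsP[]; exists z'; rewrite nz base.
- move=> w1 z; apply/negP => hh.
  by move: headr; rewrite w1 /= => /existsPn /(_ z); rewrite hh.
- move=> z base; have := hl z; rewrite /= base /= => /negbT.
  by rewrite -leqNgt.
Qed.

Theorem normal_form (f : endF2) : exists S P Q g, rep f S P Q g /\
  ((exists z, loop S z = 1) \/ good S g).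
Proof.
suff main : forall W G S P Q g, weight S < W -> size (g : F2) < G ->
    rep f S P Q g -> balanced (sd S) ->
    exists S P Q g, rep f S P Q g /\ ((exists z, loop S z = 1) \/ good S g).
  (* The starting graph is the wedge labelled by the images of the basis; putting both ends of [b]
     at [true] makes it balanced. *)
  pose S := LGraph (f gen_a) (f gen_b) 1 [ffun z : letter => z.1].
  apply: (main (weight S).+1 1%N S gen_a gen_b 1) => //.
    split; first by exists id => w; rewrite /= phi_id.
    move=> w; rewrite conjg1 phi_id /mor !loop_wr1 //.
    exact: phi_unique.
  by rewrite /balanced /= !ffunE.
elim=> // W IHW G; elim: G => // G IHG S P Q g ltW ltG r bs.
case: (rep_step r bs) => [z1|gd|[S' [P' [Q' [g' [r' bs' lt]]]]]].
- by exists S, P, Q, g; split=> //; left.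
- by exists S, P, Q, g; split=> //; right.
case: lt => [lt|[eqW lt]].
  by apply: (IHW (size g').+1 _ _ _ _ _ _ r' bs') => //; apply: leq_trans lt _.
by apply: (IHG _ _ _ _ _ _ r' bs'); [rewrite eqW|apply: leq_trans lt _].
Qed.

(** * Reading labels along paths *)

(* Directed edges: [inl z] is the edge [z], and [inr q] is [wr] or its
   inverse, directed towards the vertex [q]. *)
Notation dart := (letter + bool)%type.

Definition lab (S : lgraph) (e : dart) : F2 :=
  match e with inl z => edge S z | inr q => conn S (~~ q) q end.

Definition dinv (e : dart) : dart :=
  match e with inl z => inl (linv z) | inr q => inr (~~ q) end.

Definition based (S : lgraph) (e : dart) : bool :=
  ~~ (match e with inl z => sd S z | inr q => ~~ q end) || (wr S == 1).

Definition bridge (S : lgraph) (p q : bool) : seq dart :=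
  if (p == q) || (wr S == 1) then [::] else [:: inr q].

(* The reduced path from [p] to [false] whose sequence of non-[wr] edges
   is [U]. *)
Fixpoint walk (S : lgraph) (p : bool) (U : seq letter) : seq dart :=
  if U is z :: U' then bridge S p (sd S z) ++ inl z :: walk S (sd S (linv z)) U'
  else bridge S p false.

Lemma lab_dinv S e : lab S (dinv e) = (lab S e)^-1.
Proof. by case: e => [z|q] /=; rewrite ?edgeV ?connV ?negbK. Qed.

Lemma dinvK : involutive dinv.
Proof. by case=> [z|q] /=; rewrite ?linvK ?negbK. Qed.

Lemma prod_bridge S p q : \prod_(e <- bridge S p q) lab S e = conn S p q.
Proof.
rewrite /bridge; case: eqVneq => [->|pq] /=.
  by rewrite big_nil /conn eqxx.
case: eqVneq => [w1|_]; first by rewrite big_nil conn_wr1.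
by rewrite big_seq1 /=; congr conn; case: p q pq => [] [].
Qed.

Lemma prod_walk S p U :
  \prod_(e <- walk S p U) lab S e = conn S p false * \prod_(l <- U) loop S l.
Proof.
elim: U p => [|z U IHU] p /=; first by rewrite prod_bridge big_nil mulg1.
rewrite big_cat big_cons prod_bridge IHU big_cons /= /loop.
by rewrite -(connM S p false (sd S z)) !mulgA.
Qed.

Lemma mor_walk S U : mor S (elt U) = \prod_(e <- walk S false U) lab S e.
Proof.
rewrite prod_walk mul1g /mor phi_elt.
by apply: eq_bigr => l _; rewrite letter_image_loop.
Qed.

Definition adj (x y : F2) : bool := ohead x^-1 != ohead y.

(** Since no factor is trivial, cancellation could only occur between neighbours. *)
Lemma fword_prod (xs : seq F2) : sorted adj xs -> all (fun x => x != 1) xs ->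
  fword (\prod_(x <- xs) x) = flatten (map fword xs).
Proof.
elim: xs => [|x xs IHxs]; first by rewrite big_nil.
move=> s /= /andP[nx nxs]; rewrite big_cons.
have E := IHxs (path_sorted s) nxs.
rewrite fwordM_cat ?E // -E reduced_cat !fword_reduced /= E /junction.
case: xs s nxs {IHxs E} => [|y xs] /=; first by rewrite orbT.
rewrite fword_eq1 => /andP[axy _] /andP[ny _].
have -> : ohead (y ++ flatten (map fword xs)) = ohead y by case: (fword y) ny.
by move: axy; rewrite /adj fwordV => ->; rewrite !orbT.
Qed.

Section Walks.
Variables (S : lgraph) (g : F2).
Hypothesis gd : good S g.

Let dadj (e e' : dart) := adj (lab S e) (lab S e').

Lemma adj_edges z z' : z' != linv z ->
  (sd S (linv z) == sd S z') || (wr S == 1) -> dadj (inl z) (inl z').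
Proof.
by move=> ne base; rewrite /dadj /adj -lab_dinv; apply: (good_heads gd) => //; rewrite eq_sym.
Qed.

Lemma adj_bridge_r z q : wr S != 1 -> sd S (linv z) != q -> dadj (inl z) (inr q).
Proof.
move=> w1 ne; rewrite /dadj /adj -lab_dinv /=.
have -> : q = ~~ sd S (linv z) by case: q (sd S _) ne => [] [].
by rewrite negbK; apply: (good_headr gd).
Qed.

Lemma adj_bridge_l z : wr S != 1 -> dadj (inr (sd S z)) (inl z).
Proof.
by move=> w1; rewrite /dadj /adj -lab_dinv /= negbK eq_sym; apply: (good_headr gd).
Qed.

Lemma walk_path z U : reduced (z :: U) ->
  path dadj (inl z) (walk S (sd S (linv z)) U).
Proof.
elim: U z => [|z' U IHU] z /=.
  rewrite /bridge; case: eqVneq => //= ne; case: eqVneq => //= w1 _.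
  by rewrite adj_bridge_r.
rewrite /= => /andP[nz rU]; have := IHU z' rU.
rewrite /bridge; case: ifP => /= [b ->|/norP[ne w1] ->]; rewrite andbT.
  exact: adj_edges.
by rewrite adj_bridge_r ?adj_bridge_l.
Qed.

Lemma walk_sorted p U : reduced U -> sorted dadj (walk S p U).
Proof.
case: U => [|z U] r /=; first by rewrite /bridge; case: ifP.
have := walk_path r; rewrite /bridge; case: ifP => //= /norP[_ w1] ->.
by rewrite adj_bridge_l.
Qed.

Lemma lab_bridge p q e : e \in bridge S p q -> lab S e != 1.
Proof.
rewrite /bridge; case: ifP => // /norP[_ w1]; rewrite inE => /eqP -> /=.
by rewrite /conn; case: q; rewrite //= invg_eq1.
Qed.

Lemma lab_walk p U e : e \in walk S p U -> lab S e != 1.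
Proof.
elim: U p => [|z U IHU] p /=; first exact: lab_bridge.
rewrite mem_cat inE => /or3P[/lab_bridge //|/eqP ->|/IHU //].
exact: (good_edge gd).
Qed.

Lemma fword_walk p U : reduced U -> fword (\prod_(e <- walk S p U) lab S e) =
  flatten [seq fword (lab S e) | e <- walk S p U].
Proof.
move=> rU; rewrite -(big_map (lab S) predT id) fword_prod.
- by rewrite -map_comp.
- by rewrite sorted_map; apply: walk_sorted.
by apply/allP => x /mapP[e /lab_walk ne ->].
Qed.

(* The part of a based edge shared with the tail [g]. *)
Definition cut (e : dart) : nat := if based S e then lcp g (lab S e) else 0.

(** What is left of the label after trimming at each end the letters that may cancel against [g]. It
    survives wherever the dart stands in a path, and it is compatible with inversion. *)
Definition core (e : dart) : seq letter :=
  drop (cut e) (take (size (lab S e) - cut (dinv e)) (lab S e)).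

Lemma cut_half e : 2 * cut e <= size (lab S e).
Proof.
rewrite /cut /based; case: e => [z|q].
  by case: ifP => // /(good_lcp gd).
case: q => /=; first by move: (good_lcpr gd).
by case: eqP => //= w1; rewrite w1 /= lcpC.
Qed.

(** Two distinct ends at the base point have distinct first letters, and [g] can agree with only one
    of them. *)
Lemma cut_dinv e : cut e = 0 \/ cut (dinv e) = 0.
Proof.
have [w1|w1] := boolP (wr S == 1); last first.
  case: e => [z|[]]; rewrite /cut /based (negbTE w1) /= ?orbF; last 2 first.
  - by right.
  - by left.
  case sz: (sd S z); first by left.
  case szV: (sd S (linv z)); first by right.
  have [h|h] := eqVneq (ohead g) (ohead (edge S z)); last by left; apply: lcp_eq0.
  right; apply: lcp_eq0; rewrite {}h; apply: (good_heads gd).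
    by rewrite eq_sym linv_neq.
  by rewrite sz szV.
case: e => [z|q]; last first.
  left; rewrite /cut (_ : lab S (inr q) = 1) ?fword1 1?lcpC ?if_same //.
  exact/conn_wr1/eqP.
rewrite /cut /based w1 !orbT /=.
have [h|h] := eqVneq (ohead g) (ohead (edge S z)); last by left; apply: lcp_eq0.
right; apply: lcp_eq0; rewrite {}h; apply: (good_heads gd).
  by rewrite eq_sym linv_neq.
by rewrite w1 orbT.
Qed.

Lemma size_core e : size (core e) + cut e + cut (dinv e) = size (lab S e).
Proof.
rewrite /core size_drop size_takel ?leq_subr //.
have := cut_half e; have := cut_half (dinv e); rewrite lab_dinv size_fwordV.
by case: (cut_dinv e) => ->; lia.
Qed.

(** At most one end is trimmed, and by minimality of [g] it loses at most half. *)
Lemma core_half e : size (lab S e) <= 2 * size (core e).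
Proof.
have := size_core e; have := cut_half e; have := cut_half (dinv e).
by rewrite lab_dinv size_fwordV; case: (cut_dinv e) => ->; lia.
Qed.

Lemma core_dinv e : core (dinv e) = winv (core e).
Proof.
rewrite /core dinvK lab_dinv size_fwordV fwordV.
have h := size_core e.
rewrite winv_drop winv_take size_takel ?leq_subr // subKn; last by lia.
rewrite take_drop; congr (drop _ (take _ _)); lia.
Qed.

Lemma cut_lt e : lab S e != 1 -> cut e < size (lab S e).
Proof.
by rewrite -size_fword_gt0; have := cut_half e; lia.
Qed.

Lemma walk_first U : U != [::] ->
  exists e es, walk S false U = e :: es /\ based S e.
Proof.
case: U => // z U _ /=; rewrite /bridge.
case: ifP => /= [base|/norP[nz _]]; do 2![eexists]; split; first by [].
- by rewrite /based; case/orP: base => [/eqP <-|->]; rewrite ?orbT.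
- by [].
by rewrite /based; case: (sd S z) nz.
Qed.

Lemma walk_last p U : U != [::] ->
  exists e es, walk S p U = rcons es e /\ based S (dinv e).
Proof.
elim: U p => // z U IHU p _ /=.
case: U IHU => [_|z' U /(_ (sd S (linv z)) isT)[e [es [-> be]]]]; last first.
  exists e, (bridge S p (sd S z) ++ inl z :: es); split=> //.
  by rewrite rcons_cat.
rewrite /= {2}/bridge; case: ifP => [base|_].
  exists (inl z), (bridge S p (sd S z)); rewrite cats1; split=> //.
  by rewrite /based /=; case/orP: base => [/eqP ->|->]; rewrite ?orbT.
exists (inr false), (bridge S p (sd S z) ++ [:: inl z]).
by rewrite rcons_cat.
Qed.

End Walks.

(** * Conjugates and disjoint occurrences *)

Lemma junctionC s t : junction s t = junction (winv t) (winv s).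
Proof.
by rewrite /junction winvK !winv_nil orbCA; congr [|| _, _ | _]; rewrite eq_sym.
Qed.

Lemma junction_catl s s' t : s' != [::] -> junction (s ++ s') t = junction s' t.
Proof.
move=> ns; have : winv s' != [::] by rewrite winv_nil.
rewrite /junction winv_cat; case: (winv s') => //= x l _.
by rewrite (negbTE ns); case: s s' ns => [|? ?] [].
Qed.

Lemma junction_catr s t t' : t != [::] -> junction s (t ++ t') = junction s t.
Proof. by case: t. Qed.

(** As the letters cancelled on the left and on the right do not exhaust [x], a nonempty middle part
    remains and stops any further cancellation. *)
Lemma conj_fword (x g : F2) (k := lcp g x) (k' := lcp g (winv x)) :
  k + k' < size x ->
  fword (x ^ g) =
    winv (drop k g) ++ drop k (take (size x - k') x) ++ drop k' g.
Proof.
move=> lt; set M := drop k (take (size x - k') x).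
have sx : fword x = take k g ++ M ++ winv (take k' g).
  rewrite -{1}(cat_take_drop (size x - k') x).
  rewrite -{1}(cat_take_drop k (take (size x - k') x)) -catA.
  rewrite take_takel; last by move: lt; clear; lia.
  have -> : drop (size x - k') x = winv (take k' g).
    rewrite -[drop _ _]winvK winv_drop subKn; last by move: lt; clear; lia.
    by rewrite -(lcp_take g (winv x)).
  by rewrite -(lcp_take g x).
have M0 : M != [::].
  apply/eqP => /(congr1 size); rewrite size_drop size_takel ?leq_subr //=.
  by move: lt; clear; lia.
have E : x ^ g = elt (winv (drop k g) ++ M ++ drop k' g).
  have eg j : g = elt (take j g) * elt (drop j g) by rewrite -elt_cat cat_take_drop eltK.
  rewrite conjgE -{1}(eltK x) sx !elt_cat !elt_winv {1}(eg k) {5}(eg k').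
  by rewrite invgM !mulgA mulgVK mulgVK.
have rg j : reduced (drop j g).
  by have := fword_reduced g; rewrite -{1}(cat_take_drop j g) => /reduced_catr.
rewrite E fword_elt // !reduced_cat reduced_winvE !rg /=.
have := fword_reduced x; rewrite sx => /reduced_catr/reduced_catl ->.
rewrite junction_catr //; apply/andP; split; last first.
  have := lcp_drop g x; rewrite -/k.
  have -> : drop k x = M ++ drop (size x - k') x.
    rewrite -{1}(cat_take_drop (size x - k') x) drop_cat size_takel ?leq_subr //.
    by rewrite ifT //; move: lt; clear; lia.
  by rewrite junction_catr.
have := lcp_drop g (winv x); rewrite -/k' junctionC winvK.
have -> : winv (drop k' (winv x)) = take k x ++ M.
  rewrite winv_drop winvK size_winv -{1}(cat_take_drop k (take (size x - k') x)).
  by rewrite take_takel //; move: lt; clear; lia.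
by rewrite junction_catl.
Qed.

(** The occurrences are pairwise disjoint and come in the order of the list. *)
Fixpoint occurs (ws : seq (seq letter)) (u : seq letter) : Prop :=
  if ws is w :: ws' then exists s t, u = s ++ w ++ t /\ occurs ws' t else True.

Lemma occurs_catr ws s u : occurs ws u -> occurs ws (s ++ u).
Proof.
case: ws => //= w ws [s' [t [-> o]]]; exists (s ++ s'), t.
by rewrite catA.
Qed.

Lemma occurs_cat ws ws' u u' : occurs ws u -> occurs ws' u' ->
  occurs (ws ++ ws') (u ++ u').
Proof.
elim: ws u => [|w ws IHws] u /= o o'; first exact: occurs_catr.
case: o => s [t [-> o]]; exists s, (t ++ u'); rewrite -!catA; split=> //.
exact: IHws.
Qed.

Lemma occurs1 s w t : occurs [:: w] (s ++ w ++ t).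
Proof. by exists s, t. Qed.

Lemma occurs_refl w : occurs [:: w] w.
Proof. by exists [::], [::]; rewrite cats0. Qed.

Lemma occurs_pieces ws : occurs ws (flatten ws).
Proof.
elim: ws => // w ws IHws; apply: (@occurs_cat [:: w]) IHws.
exact: occurs_refl.
Qed.

Lemma occurs_size ws u : occurs ws u -> sumn (map size ws) <= size u.
Proof.
elim: ws u => //= w ws IHws u [s [t [-> /IHws]]].
by rewrite !size_cat; lia.
Qed.

Section Occurrences.
Variables (S : lgraph) (g : F2).
Hypothesis gd : good S g.

Lemma occurs_flatten es :
  occurs [seq core S g e | e <- es] (flatten [seq fword (lab S e) | e <- es]).
Proof.
elim: es => // e es IHes; apply: (@occurs_cat [:: core S g e]) IHes.
rewrite /core; move: (fword _) (cut _ _ _) (_ - _) => l i j.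
exists (take i (take j l)), (drop j l); split=> //.
by rewrite catA cat_take_drop cat_take_drop.
Qed.

Variables (U : seq letter) (K : nat).
Hypothesis rU : reduced U.
Hypothesis U0 : U != [::].
Hypothesis cutK : forall e, cut S g e <= K.

Let u := (mor S (elt U)) ^ g.
Let t := drop K g.

Lemma cut_catl e s : lab S e != 1 -> based S e ->
  lcp g (lab S e ++ s) = cut S g e.
Proof.
move=> ne be; have h := cut_lt gd ne.
by rewrite /cut be in h *; apply: lcp_catr.
Qed.

Lemma drop_cutE k : k <= K -> exists s, drop k g = s ++ t.
Proof.
move=> le; exists (take (K - k) (drop k g)); rewrite /t.
by rewrite -{2}(subnK le) -drop_drop cat_take_drop.
Qed.

(** [M] is the part of [u] between the two remainders of [g]. Only the first and the last dart can
    cancel against [g], so the intermediate ones keep their full labels. *)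
Lemma occurs_walk_aux : exists M, [/\
  occurs [seq core S g e | e <- walk S false U] M,
  (forall e mid e', walk S false U = e :: rcons mid e' ->
     occurs [seq fword (lab S e) | e <- mid] M) &
  exists k k', [/\ k <= K, k' <= K & fword u = winv (drop k g) ++ M ++ drop k' g]].
Proof.
have uE : fword (mor S (elt U)) = flatten [seq fword (lab S e) | e <- walk S false U].
  by rewrite mor_walk (fword_walk gd).
have [e [es [eE be]]] := walk_first S U0.
have [e' [es' [eE' be']]] := walk_last S false U0.
have ne : lab S e != 1 by apply: (lab_walk gd (p := false) (U := U)); rewrite eE mem_head.
have ne' : lab S e' != 1.
  by apply: (lab_walk gd (p := false) (U := U)); rewrite eE' mem_rcons mem_head.
have ne'V : lab S (dinv e') != 1 by rewrite lab_dinv invg_eq1.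
have k1E : lcp g (mor S (elt U)) = cut S g e by rewrite uE eE /= cut_catl.
have k2E : lcp g (winv (mor S (elt U))) = cut S g (dinv e').
  rewrite uE eE' map_rcons flatten_rcons winv_cat -fwordV -lab_dinv.
  exact: cut_catl.
have h1 := cut_half gd e; have := cut_half gd (dinv e').
rewrite lab_dinv size_fwordV => h2.
have lt1 : 0 < size (lab S e) by rewrite size_fword_gt0.
have lt2 : 0 < size (lab S e') by rewrite size_fword_gt0.
pose k := cut S g e; pose k' := cut S g (dinv e').
(* A path of one dart meets [g] at both ends, so that exactly its core survives; in longer paths the
   two extreme darts are trimmed independently. *)
case/lastP: es eE => [|es a] eE.
  have ee : e = e' by move: eE'; rewrite eE; case: es' => [|? []] // [].
  subst e'.
  exists (core S g e); split.
  - by rewrite eE; apply: occurs_refl.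
  - by move=> a mid b; rewrite eE => -[_]; case: mid.
  exists k, k'; split; rewrite ?cutK //.
  have xE : fword (mor S (elt U)) = lab S e by rewrite uE eE /= cats0.
  rewrite /u conj_fword k1E k2E.
    by rewrite /core !xE.
  by rewrite xE; have := size_core gd e; have := core_half gd e; rewrite /k /k'; lia.
have ea : a = e'.
  by move: eE'; rewrite eE -rcons_cons => /rcons_inj[_ ->].
subst a; set F := flatten [seq fword (lab S e) | e <- es].
have xE : fword (mor S (elt U)) = lab S e ++ F ++ lab S e'.
  by rewrite uE eE /= map_rcons flatten_rcons.
pose M := drop k (lab S e) ++ F ++ take (size (lab S e') - k') (lab S e').
have oM w : occurs w F -> occurs (core S g e :: rcons w (core S g e')) M.
  move=> o; rewrite -cats1 -cat1s; apply: occurs_cat; last apply: occurs_cat => //.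
    exists [::], (drop (size (lab S e) - cut S g (dinv e)) (lab S e)); split=> //.
    rewrite /core -{1}(cat_take_drop (size (lab S e) - cut S g (dinv e)) (lab S e)).
    rewrite drop_cat size_takel ?leq_subr // ifT // /k.
    by have := core_half gd e; have := size_core gd e; lia.
  exists (take (cut S g e') (take (size (lab S e') - k') (lab S e'))), [::].
  by rewrite /core cats0 cat_take_drop.
exists M; split.
- by rewrite eE /= map_rcons; apply/oM/occurs_flatten.
- move=> b mid c; rewrite eE => -[_ /rcons_inj[<- _]].
  rewrite /M; apply: occurs_catr; rewrite -[X in occurs X]cats0.
  by apply: occurs_cat => //; apply: occurs_pieces.
exists k, k'; split; rewrite ?cutK //.
rewrite /u conj_fword k1E k2E.
  congr (_ ++ (_ ++ _)); rewrite xE !size_cat.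
  rewrite catA take_cat size_cat ifF; last by rewrite -/k'; lia.
  rewrite -catA drop_cat ifT; last by rewrite /k; lia.
  congr (_ ++ (_ ++ take _ _)); rewrite /k'; lia.
by rewrite xE !size_cat; lia.
Qed.

Lemma occurs_walk :
  occurs (winv t :: rcons [seq core S g e | e <- walk S false U] t) u.
Proof.
have [M [oM _ [k [k' [lek lek' ->]]]]] := occurs_walk_aux.
have [s ->] := drop_cutE lek; have [s' ->] := drop_cutE lek'.
rewrite winv_cat -cats1 -cat1s; apply: occurs_cat.
  by rewrite -[_ ++ _]cat0s; apply: occurs1.
apply: occurs_cat => //; apply: occurs_catr; exact: occurs_refl.
Qed.

Lemma occurs_mid e mid e' : walk S false U = e :: rcons mid e' ->
  occurs [seq fword (lab S e) | e <- mid] u.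
Proof.
move=> E; have [M [_ oM [k [k' [lek lek' ->]]]]] := occurs_walk_aux.
apply: occurs_catr; rewrite -[X in occurs X]cats0; apply: occurs_cat => //.
exact: oM E.
Qed.

End Occurrences.

(** * Bounding the graph by repetitions *)

Lemma occurs_subseq ws ws' u : subseq ws ws' -> occurs ws' u -> occurs ws u.
Proof.
elim: ws' ws u => [|w' ws' IHws'] [|w ws] u //=.
case: eqP => [-> /IHws' sub [s [t [-> o]]]|_ sub [s [t [-> o]]]].
  by exists s, t; split=> //; apply: sub.
by do 2!apply: (@occurs_catr (w :: ws)); apply: (IHws' (w :: ws)).
Qed.

Definition repeated (w u v : seq letter) : Prop :=
  exists2 w', w' = w \/ w' = winv w &
    [\/ occurs [:: w; w'] u, occurs [:: w; w'] v |
        occurs [:: w] u /\ occurs [:: w'] v].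

Definition no_repeat (m : nat) (u v : seq letter) : Prop :=
  forall w, repeated w u v -> size w <= m.

Lemma occurs_infix w0 w ws u : occurs [:: w0] w -> occurs (w :: ws) u ->
  occurs (w0 :: ws) u.
Proof.
move=> [s0 [t0 [-> _]]] [s [t [-> o]]].
by exists (s ++ s0), (t0 ++ t); rewrite -!catA; split=> //; apply: occurs_catr.
Qed.

Lemma occurs_infix2 w0 w w0' w' u : occurs [:: w0] w -> occurs [:: w0'] w' ->
  occurs [:: w; w'] u -> occurs [:: w0; w0'] u.
Proof.
move=> o o' /(occurs_infix o) [s [t [-> o2]]].
by exists s, t; split=> //; exact: (@occurs_infix w0' w' [::] t o' o2).
Qed.

Lemma repeated_take m w u v : m <= size w -> repeated w u v ->
  exists2 w0, size w0 = m & repeated w0 u v.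
Proof.
move=> le [w' ww' rep]; exists (take m w); first by rewrite size_takel.
have o : occurs [:: take m w] w.
  by exists [::], (drop m w); rewrite cat_take_drop.
have [w0 [e o']] : exists w0, (w0 = take m w \/ w0 = winv (take m w)) /\ occurs [:: w0] w'.
  case: ww' => ->; first by exists (take m w); split; [left|].
  exists (winv (take m w)); split; first by right.
  exists (winv (drop m w)), [::]; split=> //.
  by rewrite cats0 -winv_cat cat_take_drop.
exists w0 => //; case: rep => [r|r|[r r']].
- by apply: Or31; apply: occurs_infix2 r.
- by apply: Or32; apply: occurs_infix2 r.
by apply: Or33; split; [apply: occurs_infix r|apply: occurs_infix r'].
Qed.

Definition kind (i : bool) : pred letter := fun l => l.1 == i.

Lemma count_subseq2 (T : eqType) (a : pred T) (s : seq T) : 1 < count a s ->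
  exists x y, [/\ a x, a y & subseq [:: x; y] s].
Proof.
rewrite -size_filter => h; have := filter_subseq a s.
have := filter_all a s; case: (seq.filter a s) h => [|x [|y l]] //= _ /and3P[ax ay _] sub.
exists x, y; split=> //; apply: subseq_trans sub.
by rewrite /= !eqxx sub0seq.
Qed.

Lemma count_subseq1 (T : eqType) (a : pred T) (s : seq T) : 0 < count a s ->
  exists x, a x /\ subseq [:: x] s.
Proof. by rewrite -has_count => /hasP[x xs ax]; exists x; rewrite sub1seq. Qed.

Lemma walk_subseq S p U : subseq (map inl U) (walk S p U).
Proof.
elim: U p => [|z U IHU] p; first by rewrite sub0seq.
by rewrite /=; apply: subseq_trans (suffix_subseq _ _); rewrite /= eqxx.
Qed.

Section Bounds.
Variables (S : lgraph) (g : F2).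
Hypothesis gd : good S g.

Lemma occurs_core U : reduced U -> U != [::] ->
  occurs [seq core S g e | e <- walk S false U] ((mor S (elt U)) ^ g).
Proof.
(* Only cores matter here, so any common bound on the cuts will do; a sharp one is used later to
   bound [g]. *)
move=> rU U0; pose K := \max_(z : letter) cut S g (inl z) + \max_q cut S g (inr q).
have cK e : cut S g e <= K.
  rewrite /K; case: e => x.
    by apply: leq_trans (leq_addr _ _); apply: (leq_bigmax x).
  by apply: leq_trans (leq_addl _ _); apply: (leq_bigmax x).
apply: occurs_subseq (occurs_walk gd rU U0 cK).
apply: subseq_trans (subseq_cons _ _).
by rewrite -cats1 prefix_subseq.
Qed.

(** Every core contributes at least one letter. *)
Lemma size_walk U : reduced U -> U != [::] ->
  size (walk S false U) <= size ((mor S (elt U)) ^ g).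
Proof.
move=> rU U0; have := occurs_size (occurs_core rU U0); apply: leq_trans.
rewrite -map_comp -(size_map (core S g)).
have : all (fun e => 0 < size (core S g e)) (walk S false U).
  apply/allP => e /(lab_walk gd); rewrite -size_fword_gt0.
  by have := core_half gd e; lia.
elim: (walk S false U) => //= e es IHes /andP[h /IHes].
by rewrite -(add1n (size _)) => /(leq_add h).
Qed.

Variables (U V : seq letter) (m : nat).
Hypotheses (rU : reduced U) (U0 : U != [::]) (rV : reduced V) (V0 : V != [::]).
Let u := (mor S (elt U)) ^ g.
Let v := (mor S (elt V)) ^ g.
Hypothesis nr : no_repeat m u v.

Lemma core_kind i z z' : kind i z -> kind i z' ->
  core S g (inl z') = core S g (inl z) \/
  core S g (inl z') = winv (core S g (inl z)).
Proof.
rewrite /kind; case: (eqVneq z z') => [->|ne /eqP e /eqP e']; first by left.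
by right; rewrite (linv_eqV ne) ?e // -core_dinv.
Qed.

(** Two traversals of an edge produce two disjoint copies of its core, up to inversion; hence the
    core has length at most m and the label at most 2m. *)
Lemma edge_bound i : 1 < count (kind i) U + count (kind i) V ->
  forall z, kind i z -> size (edge S z) <= 2 * m.
Proof.
move=> h z iz.
suff : size (core S g (inl z)) <= m.
  by have := core_half gd (inl z); rewrite /=; lia.
have [x [y [ix iy r]]] : exists x y, [/\ kind i x, kind i y &
   [\/ occurs [:: core S g (inl x); core S g (inl y)] u,
       occurs [:: core S g (inl x); core S g (inl y)] v |
       occurs [:: core S g (inl x)] u /\ occurs [:: core S g (inl y)] v]].
  have sub W ws : subseq ws W -> subseq [seq core S g (inl x) | x <- ws]
      [seq core S g e | e <- walk S false W].
    move=> s; rewrite (map_comp (core S g) inl); apply: map_subseq.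
    by apply: subseq_trans (walk_subseq _ _ _); apply: map_subseq.
  have [hU|hU] := ltnP 1 (count (kind i) U).
    have [x [y [ix iy /sub s]]] := count_subseq2 hU; exists x, y; split=> //.
    by apply: Or31; apply: occurs_subseq (occurs_core rU U0).
  have [hV|hV] := ltnP 1 (count (kind i) V).
    have [x [y [ix iy /sub s]]] := count_subseq2 hV; exists x, y; split=> //.
    by apply: Or32; apply: occurs_subseq (occurs_core rV V0).
  have hU1 : 0 < count (kind i) U by lia.
  have hV1 : 0 < count (kind i) V by lia.
  have [x [ix /sub s]] := count_subseq1 hU1; have [y [iy /sub s']] := count_subseq1 hV1.
  exists x, y; split=> //; apply: Or33; split.
    by apply: occurs_subseq (occurs_core rU U0).
  by apply: occurs_subseq (occurs_core rV V0).
have -> : size (core S g (inl z)) = size (core S g (inl x)).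
  by case: (core_kind ix iz) => ->; rewrite ?size_winv.
by apply: nr; exists (core S g (inl y)) => //; apply: core_kind ix iy.
Qed.

Lemma walk_back W : wr S != 1 -> (forall z, sd S z = sd S (linv z)) ->
  inr false \in walk S true W.
Proof.
move=> w1 loops; elim: W => [|z W IHW] /=.
  by rewrite /bridge (negbTE w1) /= inE.
rewrite mem_cat inE -loops /bridge (negbTE w1) orbF.
by case: (sd S z); rewrite /= ?inE ?IHW ?orbT.
Qed.

(** In a barbell the far loop is reached only across [wr], which must be crossed again on the way
    back. *)
Lemma walk_bridge W z : wr S != 1 -> (forall z, sd S z = sd S (linv z)) ->
  z \in W -> sd S z -> subseq [:: inr true; inr false] (walk S false W).
Proof.
move=> w1 loops zW sz; elim: W zW => // y W IHW; rewrite inE => h.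
case sy : (sd S y).
  rewrite /= sy -loops sy /bridge (negbTE w1) /= sub1seq.
  by rewrite walk_back.
have zW : z \in W by case/orP: h => // /eqP zy; rewrite zy sy in sz.
rewrite /= sy -loops sy /bridge /=; exact: (IHW zW).
Qed.

Lemma occurs_tail K : (forall e, cut S g e <= K) ->
  repeated (winv (drop K g)) u v.
Proof.
move=> cK; exists (drop K g); first by right; rewrite winvK.
apply: Or31; apply: occurs_subseq (occurs_walk gd rU U0 cK).
by rewrite /= eqxx sub1seq mem_rcons mem_head.
Qed.

Lemma graph_bound : (forall i, 1 < count (kind i) U + count (kind i) V) ->
  [/\ size (wa S) <= 2 * m, size (wb S) <= 2 * m, size (wr S) <= 2 * m &
      size g <= 2 * m].
Proof.
move=> h; have eb z : size (edge S z) <= 2 * m.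
  by apply: (edge_bound (h z.1)); apply: eqxx.
have rb : size (wr S) <= 2 * m.
  have [->|w1] := eqVneq (wr S) 1; first by [].
  (* In a theta graph [wr] is no longer than the other edges; in a barbell it is itself traversed
     twice. *)
  have [z nz|loops] := pickP [pred z | sd S z != sd S (linv z)].
    exact: leq_trans (good_short gd nz) (eb z).
  have {}loops z : sd S z = sd S (linv z).
    by apply/eqP; have := loops z => /negbFE.
  have [z sz] : exists z, sd S z.
    have [z' _ e] := balanced_other (false, false) (good_bal gd).
    have := good_bal gd; rewrite /balanced.
    case s1: (sd S (false, false)); first by exists (false, false).
    case s2: (sd S (false, true)); first by exists (false, true).
    case s3: (sd S (true, false)); first by exists (true, false).
    case s4: (sd S (true, true)); first by exists (true, true).
    by [].
  have mem : (exists2 y, y \in U & sd S y) \/ (exists2 y, y \in V & sd S y).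
    have K W : 0 < count (kind z.1) W -> exists2 y, y \in W & sd S y.
      rewrite -has_count => /hasP[y yW iy]; exists y => //.
      have [->//|ne] := eqVneq y z.
      by rewrite loops -(linv_eqV ne) //; apply/eqP.
    have := h z.1; case: (posnP (count (kind z.1) U)) => [->|/K]; last by left.
    by rewrite add0n => hV; right; apply: K; apply: ltnW.
  suff : size (core S g (inr true)) <= m.
    by have := core_half gd (inr true); rewrite -[lab S (inr true)]/(wr S); lia.
  apply: nr; exists (core S g (inr false)).
    by right; rewrite -core_dinv.
  have sub W y : y \in W -> sd S y -> subseq [:: core S g (inr true); core S g (inr false)]
      [seq core S g e | e <- walk S false W].
    by move=> yW sy; apply: (map_subseq _ (walk_bridge w1 loops yW sy)).
  case: mem => -[y yW sy]; [apply: Or31|apply: Or32];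
    by apply: (occurs_subseq (sub _ _ yW sy)); apply: occurs_core.
have lb e : size (lab S e) <= 2 * m.
  case: e => [z|q] /=; first exact: eb.
  by case: q; rewrite /conn //= size_winv.
split=> //; [exact: (eb (false, false))|exact: (eb (true, false))|].
(* All cuts are at most m, so [drop m g] is repeated, and at most m letters of [g] follow the first
   m. *)
have cK e : cut S g e <= m by have := cut_half gd e; have := lb e; lia.
by have := nr (occurs_tail cK); rewrite size_winv size_drop; lia.
Qed.

Lemma mor_inj W : reduced W -> mor S (elt W) = 1 -> W = [::].
Proof.
move=> rW e; have := fword_walk gd false rW; rewrite -mor_walk e.
case: W rW {e} => // z W rW E; have := walk_subseq S false (z :: W).
case E2 : (walk S false (z :: W)) => [|d ds] // _.
have : d \in walk S false (z :: W) by rewrite E2 mem_head.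
move/(lab_walk gd); move: E; rewrite E2 /= fword_eq1.
by case: (fword (lab S d)).
Qed.

End Bounds.

(** * Few traversals force an automorphism *)

Definition proper_power (x : F2) : Prop := exists h k, 1 < k /\ x = h ^+ k.

Definition coincident (u v : F2) : Prop := [\/ u = 1, v = 1, u = v | u = v^-1].

(** Membership in the cyclic subgroup of [h], with the integer exponent written as a difference of
    natural numbers. *)
Definition cyclic_in (h x : F2) : Prop := exists a b, x = h ^+ a * (h ^+ b)^-1.

Lemma cyclic_inP h x : cyclic_in h x -> [\/ x = 1, x = h, x = h^-1 | proper_power x].
Proof.
case=> a [b ->]; have [le|/ltnW le] := leqP b a.
  rewrite -expgnFr //; case: (a - b) => [|[|k]].
  - exact: Or41.
  - exact: Or42.
  by apply: Or44; exists h, k.+2.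
have -> : h ^+ a / h ^+ b = h^-1 ^+ (b - a).
  by rewrite expVgn expgnFr // invgF.
case: (b - a) => [|[|k]].
- exact: Or41.
- exact: Or43.
by apply: Or44; exists h^-1, k.+2.
Qed.

Lemma cyclic_in_pair h u v : cyclic_in h u -> cyclic_in h v ->
  [\/ proper_power u, proper_power v | coincident u v].
Proof.
move=> /cyclic_inP cu /cyclic_inP cv.
case: cu => [->|eu|eu|pu]; last exact: Or31.
- by apply: Or33; apply: Or41.
- case: cv => [->|ev|ev|pv]; last exact: Or32.
  + by apply: Or33; apply: Or42.
  + by apply: Or33; apply: Or43; rewrite eu.
  + by apply: Or33; apply: Or44; rewrite eu ev invgK.
case: cv => [->|ev|ev|pv]; last exact: Or32.
+ by apply: Or33; apply: Or42.
+ by apply: Or33; apply: Or44; rewrite eu ev.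
by apply: Or33; apply: Or43; rewrite eu.
Qed.

Lemma phi_cyclic u v z : letter_image u v z = 1 ->
  exists h, forall w, cyclic_in h (phi u v w).
Proof.
move=> z1; exists (if z.1 then u else v) => w.
have [l1 l2] : (forall l, l.1 = z.1 -> letter_image u v l = 1) /\
   (forall l, l.1 != z.1 -> letter_image u v l = (if z.1 then u else v) \/
      letter_image u v l = (if z.1 then u else v)^-1).
  have e1 : (if z.1 then v else u) = 1.
    by case: z z1 => [[] []]; rewrite /letter_image //= => /eqP; rewrite ?invg_eq1 => /eqP.
  by split=> -[[] []]; rewrite /letter_image; case: (z.1) e1 => //= e1 _;
    rewrite ?e1 ?invg1; first [by [] | by left | by right].
rewrite /phi; elim: (fword w) => [|l s [a [b IHs]]].
  by exists 0, 0; rewrite big_nil !expg0 invg1 mulg1.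
rewrite big_cons IHs; set h := (if z.1 then u else v) in l2 *.
have [e|ne] := eqVneq l.1 z.1; first by exists a, b; rewrite l1 // mul1g.
case: (l2 l ne) => ->; first by exists a.+1, b; rewrite expgS mulgA.
exists a, b.+1; rewrite expgSr invgM !mulgA; congr (_ * _).
by apply/commute_sym/commuteV/commute_sym/commuteX.
Qed.

Lemma phi_bij_comp u v x y : bijective (phi u v) -> bijective (phi x y) ->
  bijective (phi (phi u v x) (phi u v y)).
Proof.
by move=> b b'; apply: (eq_bij (bij_comp b b')) => w /=; rewrite phi_comp.
Qed.

Lemma phi_letters_bij x y : x.1 != y.1 -> bijective (phi (lett x) (lett y)).
Proof.
move=> ne; suff [x' [y' [h1 h2 h3 h4]]] : exists x' y' : letter,
    [/\ letter_image (lett x) (lett y) x' = gen_a, letter_image (lett x) (lett y) y' = gen_b,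
        letter_image (lett x') (lett y') x = gen_a & letter_image (lett x') (lett y') y = gen_b].
  by exists (phi (lett x') (lett y')) => w; rewrite phi_comp /= !phi_lett ?h1 ?h2 ?h3 ?h4 phi_id.
case: x y ne => [[] s] [[] t] // _.
  exists (true, t), (false, s); case: s; case: t; split; exact: fword_inj.
exists (false, s), (true, t); case: s; case: t; split; exact: fword_inj.
Qed.

Lemma phi_swap_bij u v : bijective (phi u v) -> bijective (phi v u).
Proof.
move=> b; have b' : bijective (phi gen_b gen_a).
  by rewrite gen_aE gen_bE; apply: phi_letters_bij.
by have := phi_bij_comp b b'; rewrite phi_gen_a phi_gen_b.
Qed.

(** These are elementary Nielsen transformations. *)
Lemma phi_mul_bij u y (h : F2) : h = lett y \/ h = lett (linv y) ->
  bijective (phi u (lett y)) ->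
  bijective (phi (h * u) (lett y)) /\ bijective (phi (u * h) (lett y)).
Proof.
move=> hy b.
have [k kh] : exists k, h = phi u (lett y) k /\ (k = gen_b \/ k = gen_b^-1).
  case: hy => ->.
    by exists gen_b; rewrite phi_gen_b; split; [|left].
  by exists gen_b^-1; rewrite gmulfV /= phi_gen_b lettV; split; [|right].
have kb x : phi x gen_b k = k.
  by case: kh => _ [] ->; rewrite ?gmulfV /= phi_gen_b.
have kVb x : phi x gen_b k^-1 = k^-1 by rewrite gmulfV /= kb.
split.
  have b' : bijective (phi (k * gen_a) gen_b).
    exists (phi (k^-1 * gen_a) gen_b) => w; rewrite phi_comp gmulfM /= phi_gen_a phi_gen_b.
      by rewrite kb mulVKg phi_id.
    by rewrite kVb mulKg phi_id.
  have := phi_bij_comp b b'; rewrite gmulfM /= phi_gen_a phi_gen_b.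
  by case: kh => <-.
have b' : bijective (phi (gen_a * k) gen_b).
  exists (phi (gen_a * k^-1) gen_b) => w; rewrite phi_comp gmulfM /= phi_gen_a phi_gen_b.
    by rewrite kb mulgVK phi_id.
  by rewrite kVb mulgK phi_id.
have := phi_bij_comp b b'; rewrite gmulfM /= phi_gen_a phi_gen_b.
by case: kh => <-.
Qed.

Lemma reduced_kind i s : reduced s -> count (kind i) s = 0 ->
  exists k y, y.1 = ~~ i /\ s = nseq k y.
Proof.
elim: s => [|x s IHs]; first by exists 0, (~~ i, false).
rewrite reduced_cons => /andP[rs hx] /=; case kx : (kind i x) => //= c0.
have xi : x.1 = ~~ i by move: kx; rewrite /kind; case: (x.1); case: (i).
have [[|k] [y [yi sE]]] := IHs rs c0; first by exists 1%N, x; rewrite sE.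
exists k.+2, x; split=> //; rewrite sE /=; move: hx; rewrite sE /= => hx.
suff -> : y = x by [].
apply/eqP; apply: contraNT hx => ne; apply/eqP; congr Some.
by apply: linv_eqV; [rewrite eq_sym|rewrite xi].
Qed.

Lemma elt_nseq k y : elt (nseq k y) = lett y ^+ k.
Proof.
elim: k => [|k IHk]; first by rewrite elt_nil.
by rewrite /= (elt_cat [:: y]) elt_seq1 IHk expgS.
Qed.

Lemma phi_single_bij A B x y : x.1 != y.1 ->
  all (fun l => l.1 == y.1) A -> all (fun l => l.1 == y.1) B ->
  bijective (phi (elt (A ++ x :: B)) (lett y)).
Proof.
move=> nxy; have hy l : l.1 == y.1 -> lett l = lett y \/ lett l = lett (linv y).
  move=> e; have [->|ne] := eqVneq y l; first by left.
  by right; rewrite (linv_eqV ne) // (eqP e).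
move=> allA allB; elim: A allA => [_|l A IHA] /=; last first.
  move=> /andP[ly /IHA b]; rewrite (elt_cat [:: l]) elt_seq1.
  by case: (phi_mul_bij (hy _ ly) b).
rewrite -cat1s elt_cat elt_seq1; elim/last_ind: B allB => [_|B l IHB].
  by rewrite elt_nil mulg1; apply: phi_letters_bij.
rewrite all_rcons => /andP[ly /IHB b]; rewrite -cats1 elt_cat elt_seq1 mulgA.
by case: (phi_mul_bij (hy _ ly) b).
Qed.

(** [V] is a power of a letter [y], and only [V = y] is not exceptional. Then [U] is either a power
    of a letter of the same kind or of the form y^p x y^q, which together with [y] is a basis. *)
Lemma few_letters i U V : reduced U -> reduced V ->
  count (kind i) V = 0 -> count (kind i) U <= 1 ->
  [\/ proper_power (elt U), proper_power (elt V), coincident (elt U) (elt V) |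
      bijective (phi (elt U) (elt V))].
Proof.
move=> rU rV c0 c1; have [k [y [yi VE]]] := reduced_kind rV c0.
case: k VE => [|[|k]] VE; last 1 first.
- by apply: Or42; exists (lett y), k.+2; rewrite VE elt_nseq.
- by apply: Or43; apply: Or42; rewrite VE elt_nil.
rewrite {V rV c0}VE /= elt_seq1.
case: (posnP (count (kind i) U)) => [c0|c1'].
  have [j [x [xi UE]]] := reduced_kind rU c0.
  case: j UE => [|[|j]] UE; last 1 first.
  - by apply: Or41; exists (lett x), j.+2; rewrite UE elt_nseq.
  - by apply: Or43; apply: Or41; rewrite UE elt_nil.
  rewrite UE /= elt_seq1; apply: Or43; have [->|ne] := eqVneq x y; first exact: Or43.
  by apply: Or44; rewrite lettV; rewrite eq_sym in ne; rewrite (linv_eqV ne) // xi.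
apply: Or44; move: c1'; rewrite -has_count => /hasP[x xU kx].
move: c1; clear rU; case/splitPr: xU => A B; rewrite count_cat /= kx => c1.
have off s : count (kind i) s = 0 -> all (fun l => l.1 == y.1) s.
  move=> c; apply/allP => l ls; have : ~~ has (kind i) s by rewrite has_count c.
  by move=> /hasPn /(_ l ls); rewrite /kind yi; case: (l.1); case: (i).
apply: phi_single_bij.
- by move: kx; rewrite /kind yi => /eqP ->; case: (i).
- by apply: off; lia.
by apply: off; lia.
Qed.

Definition exceptional (u v : F2) : Prop :=
  [\/ proper_power u, proper_power v | coincident u v].

Lemma cyclic_in_conj h g x : cyclic_in h x -> cyclic_in (h ^ g) (x ^ g).
Proof. by case=> a [b ->]; exists a, b; rewrite conjMg conjVg !conjXg. Qed.

Lemma rep_loop1 (f : endF2) S P Q g z x y : rep f S P Q g -> loop S z = 1 ->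
  exceptional (f x) (f y).
Proof.
move=> [_ fE] z1; have [|h hP] := @phi_cyclic (loop S (false, false)) (loop S (true, false)) z.
  by rewrite letter_image_loop.
by apply: (@cyclic_in_pair (h ^ g)); rewrite fE; apply: cyclic_in_conj; apply: hP.
Qed.

Lemma exceptional_morph S g U V : exceptional (elt U) (elt V) ->
  exceptional ((mor S (elt U)) ^ g) ((mor S (elt V)) ^ g).
Proof.
have pw W : proper_power (elt W) -> proper_power ((mor S (elt W)) ^ g).
  case=> h [k [k1 ->]]; exists ((mor S h) ^ g), k; split=> //.
  by rewrite /mor gmulfXn /= conjXg.
case=> [/pw|/pw|c]; [exact: Or31|exact: Or32|apply: Or33].
case: c => [->|->|->|->]; rewrite /mor ?gmulfV ?gmulf1 /= ?conjVg ?conj1g.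
- exact: Or41.
- exact: Or42.
- exact: Or43.
exact: Or44.
Qed.

Lemma nonexceptional_inj (u v : F2) : ~ exceptional u v -> injective (phi u v).
Proof.
move=> nex; have [S [P [Q [g [r [[z z1]|gd]]]]]] := normal_form (phi u v).
  case: nex; have := rep_loop1 gen_a gen_b r z1.
  by rewrite /= phi_gen_a phi_gen_b.
case: r => bij fE; apply: gmulf_inj => w /=; rewrite fE.
move=> /(congr1 (fun x => x ^ g^-1)); rewrite conjgK conj1g => e.
apply: (bij_inj bij); rewrite gmulf1; apply: fword_inj; apply: (mor_inj gd).
  exact: fword_reduced.
by rewrite eltK.
Qed.

(** Distinct first letters force the two one-letter labels to involve different generators. *)
Lemma mor_letters_bij S : wr S = 1 ->
  (forall z z', z != z' -> ohead (edge S z) != ohead (edge S z')) ->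
  size (wa S) = 1%N -> size (wb S) = 1%N -> bijective (mor S).
Proof.
move=> w1 heads sa sb.
have [x xE] : exists x, wa S = lett x.
  by case: (fword (wa S)) (eltK (wa S)) sa => [|x []] // <- _; exists x; exact: elt_seq1.
have [y yE] : exists y, wb S = lett y.
  by case: (fword (wb S)) (eltK (wb S)) sb => [|y []] // <- _; exists y; exact: elt_seq1.
rewrite /mor !loop_wr1 // /edge /letter_image /= xE yE.
apply: phi_letters_bij; apply/eqP => e.
have h1 := heads (false, false) (true, false) isT.
have h2 := heads (false, true) (true, false) isT.
move: h1 h2; rewrite /edge /letter_image /= xE yE /= => h1 h2.
have ne : x != y by apply: contra h1 => /eqP ->.
by case/negP: h2; rewrite (linv_eqV ne).
Qed.

Theorem nonprime_structure m (u v : F2) : no_repeat m u v -> ~ exceptional u v ->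
  ~ prime_endo (phi u v) -> exists S g U V,
  [/\ good S g /\ ~ (wr S = 1 /\ size (wa S) = 1%N /\ size (wb S) = 1%N),
     [/\ reduced U, reduced V, U != [::] & V != [::]],
     u = (mor S (elt U)) ^ g /\ v = (mor S (elt V)) ^ g &
     [/\ size (wa S) <= 2 * m, size (wb S) <= 2 * m, size (wr S) <= 2 * m &
         size g <= 2 * m]].
Proof.
move=> nr nex np; have finj := nonexceptional_inj nex.
have [al [be [fE nal nbe]]] : exists al be : endF2,
    [/\ phi u v =1 al \o be, ~ bijective al & ~ bijective be].
  apply: boolp.contrapT => H; apply: np; split=> // al be fE.
  apply: boolp.contrapT => /boolp.not_orP[na nb].
  by apply: H; exists al, be.
have [S [P [Q [g [r [[z z1]|gd]]]]]] := normal_form al.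
  have := rep_loop1 (be gen_a) (be gen_b) r z1.
  have -> : al (be gen_a) = u by rewrite -[RHS](phi_gen_a u v) fE.
  by have -> : al (be gen_b) = v by rewrite -[RHS](phi_gen_b u v) fE.
case: r => bij aE.
(* The change of basis is absorbed into the second factor, so [u] and [v] are read along the paths
   [U] and [V]. *)
pose U := fword (phi P Q (be gen_a)); pose V := fword (phi P Q (be gen_b)).
have uE : u = (mor S (elt U)) ^ g by rewrite -(phi_gen_a u v) fE /= aE eltK.
have vE : v = (mor S (elt V)) ^ g by rewrite -(phi_gen_b u v) fE /= aE eltK.
have rU : reduced U := fword_reduced _.
have rV : reduced V := fword_reduced _.
have U0 : U != [::].
  apply/eqP => e; apply: nex; apply: Or33; apply: Or41.
  by rewrite uE e elt_nil /mor gmulf1 conj1g.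
have V0 : V != [::].
  apply/eqP => e; apply: nex; apply: Or33; apply: Or42.
  by rewrite vE e elt_nil /mor gmulf1 conj1g.
(* [be] is this map followed by the inverse of [phi P Q]. *)
have nbUV : ~ bijective (phi (elt U) (elt V)).
  move=> b; apply: nbe; case: (bij) => q pq qp.
  apply: (eq_bij (bij_comp (Bijective qp pq) b)) => w /=.
  by rewrite !eltK -phi_comp pq -phi_unique.
have nexUV : ~ exceptional (elt U) (elt V).
  by move=> /(exceptional_morph S g); rewrite -uE -vE.
have cnt i : 1 < count (kind i) U + count (kind i) V.
  rewrite ltnNge; apply/negP => le.
  have h W W' : reduced W -> reduced W' -> count (kind i) W = 0 -> count (kind i) W' <= 1 ->
      exceptional (elt W') (elt W) \/ bijective (phi (elt W') (elt W)).
    move=> rW rW' c0 c1; case: (few_letters rW' rW c0 c1) => [p|p|c|b]; last by right.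
    - by left; apply: Or31.
    - by left; apply: Or32.
    by left; apply: Or33.
  case: (posnP (count (kind i) V)) => [c0|c1].
    have c1 : count (kind i) U <= 1 by lia.
    by case: (h _ _ rV rU c0 c1).
  have c0 : count (kind i) U = 0 by lia.
  have c1' : count (kind i) V <= 1 by lia.
  case: (h _ _ rU rV c0 c1') => [[p|p|c]|/phi_swap_bij //].
  - by apply: nexUV; apply: Or32.
  - by apply: nexUV; apply: Or31.
  apply: nexUV; apply: Or33; case: c => [->|->|->|->].
  - exact: Or42.
  - exact: Or41.
  - exact: Or43.
  by apply: Or44; rewrite invgK.
rewrite uE vE in nr.
exists S, g, U, V; split=> //; last exact: (graph_bound gd rU U0 rV V0 nr cnt).
split=> // -[w1 [sa sb]]; apply: nal.
have b : bijective (mor S).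
  by apply: mor_letters_bij => // z z' ne; apply: (good_heads gd) => //; rewrite w1 eqxx orbT.
apply: (eq_bij (bij_comp (conjg_bij g) (bij_comp b bij))) => w /=.
by rewrite aE.
Qed.

Local Open Scope nat_scope.

(** * Counting *)

Definition letters : seq letter :=
  [:: (false, false); (false, true); (true, false); (true, true)].

Lemma mem_letters l : l \in letters. Proof. by case: l => [[] []]. Qed.

Definition nexts (z : letter) : seq letter := [seq z' <- letters | z' != linv z].

Fixpoint ext (z : letter) (k : nat) : seq (seq letter) :=
  if k is k'.+1 then flatten [seq [seq z' :: w | w <- ext z' k'] | z' <- nexts z]
  else [:: [::]].

Lemma size_nexts z : size (nexts z) = 3.
Proof. by case: z => [[] []]. Qed.

Lemma size_flatten_eq (T U : Type) (F : T -> seq U) (s : seq T) k :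
  (forall x, size (F x) = k) -> size (flatten [seq F x | x <- s]) = (size s * k)%N.
Proof. by move=> e; elim: s => //= x s IHs; rewrite size_cat IHs e mulSn. Qed.

Lemma size_flatten_le (T : eqType) (U : Type) (F : T -> seq U) (s : seq T) k :
  (forall x, x \in s -> size (F x) <= k) ->
  size (flatten [seq F x | x <- s]) <= size s * k.
Proof.
elim: s => //= x s IHs le; rewrite size_cat mulSn leq_add ?le ?mem_head //.
by apply: IHs => y ys; apply: le; rewrite inE ys orbT.
Qed.

Lemma size_ext z k : size (ext z k) = (3 ^ k)%N.
Proof.
elim: k z => //= k IHk z.
by rewrite (@size_flatten_eq _ _ _ _ (3 ^ k)) ?size_nexts ?expnS // => y; rewrite size_map IHk.
Qed.

Lemma mem_ext z w : (w \in ext z (size w)) = reduced (z :: w).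
Proof.
elim: w z => [|y w IHw] z //=.
rewrite -[path _ _ _]/(reduced (y :: w)) -IHw.
apply/flatten_mapP/andP => [[x xz /mapP[w' w'x [yx ww]]]|[ne yw]].
  by subst x w'; move: xz; rewrite mem_filter => /andP[-> _]; split.
exists y; first by rewrite mem_filter ne mem_letters.
exact: (map_f (cons y)) yw.
Qed.

Lemma ext_size z k w : w \in ext z k -> size w = k.
Proof.
elim: k z w => [|k IHk] z w /=; first by rewrite inE => /eqP ->.
by case/flatten_mapP => x _ /mapP[w' /IHk <- ->].
Qed.

Lemma uniq_ext z k : uniq (ext z k).
Proof.
elim: k z => // k IHk z /=.
have : uniq (nexts z) by apply: filter_uniq.
elim: (nexts z) => //= x s IHs /andP[xs us]; rewrite cat_uniq IHs // andbT.
rewrite map_inj_uniq ?IHk /=; last by move=> a b [].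
apply/hasPn => w /flatten_mapP[y ys /mapP[w' _ ->]].
apply/negP => /mapP[w'' _ [yx _]].
by rewrite yx in ys; rewrite ys in xs.
Qed.

Definition words_succ (j : nat) : seq (seq letter) :=
  flatten [seq [seq z :: w | w <- ext z j] | z <- letters].

Lemma size_words_succ j : size (words_succ j) = (4 * 3 ^ j)%N.
Proof.
by rewrite (@size_flatten_eq _ _ _ _ (3 ^ j)) // => z; rewrite size_map size_ext.
Qed.

Definition ball_words (k : nat) : seq (seq letter) :=
  [::] :: flatten [seq words_succ j | j <- iota 0 k].

Definition ball (k : nat) : seq F2 := map elt (ball_words k).

Lemma mem_ball k (x : F2) : size x <= k -> x \in ball k.
Proof.
move=> le; apply/mapP; exists (fword x); last by rewrite eltK.
rewrite inE; case E : (fword x) le => [|z w] le; first by [].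
rewrite orFb.
apply/flatten_mapP; exists (size w); first by rewrite mem_iota.
apply/flatten_mapP; exists z; first exact: mem_letters.
by apply: map_f; rewrite mem_ext -E fword_reduced.
Qed.

Lemma size_ball k : size (ball k) <= 2 * 3 ^ k.
Proof.
rewrite size_map /=; elim: k => // k IHk.
have -> : iota 0 k.+1 = iota 0 k ++ [:: k] by rewrite -addn1 iotaD.
rewrite map_cat flatten_cat size_cat /= cats0 size_words_succ expnS.
by move: IHk; lia.
Qed.

Lemma mem_ball_elt k s : reduced s -> size s <= k -> s \in map fword (ball k).
Proof.
move=> rs le; apply/mapP; exists (elt s); last by rewrite fword_elt.
by apply: mem_ball; rewrite fword_elt.
Qed.

(** * Pairs with a long repetition *)

Definition factor (m i : nat) (b : bool) (x : seq letter) : seq letter :=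
  if b then winv (take m (drop i x)) else take m (drop i x).

(** The m letters between [x] and [y] are copied, possibly inverted, from position [i] of [src x],
    so they cost no choice and a factor 3^m is saved. With [src] the identity the copy is taken from
    the prefix [x], with [src] constant from another word. *)
Definition inserts (m n : nat) (src : seq letter -> seq letter) : seq F2 :=
  flatten [seq flatten [seq flatten [seq flatten [seq
    [seq elt (x ++ factor m i b (src x) ++ y) | y : F2 <- ball (n - m - j)]
    | x : F2 <- ball j] | b <- [:: false; true]] | i <- iota 0 n.+1] | j <- iota 0 (n - m).+1].

Lemma size_inserts m n src :
  size (inserts m n src) <= (n - m).+1 * (n.+1 * (2 * (4 * 3 ^ (n - m)))).
Proof.
rewrite -{1}(size_iota 0 (n - m).+1); apply: size_flatten_le => j.
rewrite mem_iota add0n ltnS => jn.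
rewrite -[X in (X * (2 * _))%N](size_iota 0 n.+1); apply: size_flatten_le => i _.
apply: (@size_flatten_le _ _ _ [:: false; true]) => b _.
apply: leq_trans (_ : size (ball j) * (2 * 3 ^ (n - m - j)) <= _).
  by apply: size_flatten_le => x _; rewrite size_map size_ball.
apply: leq_trans (leq_mul (size_ball j) (leqnn _)) _.
by rewrite mulnACA -expnD subnKC.
Qed.

Lemma mem_inserts m n (src : seq letter -> seq letter) (s w w' t : seq letter) i :
  reduced (s ++ w' ++ t) -> size (s ++ w' ++ t) <= n -> size w' = m ->
  i <= n -> take m (drop i (src s)) = w -> (w' = w \/ w' = winv w) ->
  elt (s ++ w' ++ t) \in inserts m n src.
Proof.
move=> r le sw ile srcE ww; rewrite !size_cat sw in le.
apply/flatten_mapP; exists (size s); first by rewrite mem_iota /=; lia.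
apply/flatten_mapP; exists i; first by rewrite mem_iota.
apply/flatten_mapP; exists (w' == winv w); first by case: (_ == _).
have /mapP[x xb sx] := @mem_ball_elt (size s) s (reduced_catl r) (leqnn _).
have rt : reduced t := reduced_catr (reduced_catr r).
have tn : size t <= n - m - size s by lia.
have /mapP[y yb ty] := mem_ball_elt rt tn.
apply/flatten_mapP; exists x => //; apply/mapP; exists y => //.
rewrite -sx -ty /factor srcE; case: ww => ->; case: eqP => // e.
by rewrite -e.
Qed.

Definition repeat_pairs (m n : nat) : seq (F2 * F2) :=
  [seq (u, v) | u <- inserts m n id, v <- ball n] ++
  [seq (u, v) | u <- ball n, v <- inserts m n id] ++
  flatten [seq [seq (u, v) | v <- inserts m n (fun=> fword u)] | u <- ball n].

Lemma size_repeat_pairs m n : m <= n ->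
  size (repeat_pairs m n) <= 48 * n.+1 ^ 2 * 3 ^ (n + (n - m)).
Proof.
move=> mn; rewrite -mulnA; set K := n.+1 ^ 2 * _.
have hb := size_ball n; have hi src := size_inserts m n src.
have hE : 2 * 3 ^ n * ((n - m).+1 * (n.+1 * (2 * (4 * 3 ^ (n - m))))) <= 16 * K.
  rewrite /K expnD; move: (3 ^ n) (3 ^ (n - m)) => a b.
  have : (n - m).+1 * (n.+1 * (a * b)) <= n.+1 ^ 2 * (a * b).
    by rewrite mulnA leq_mul // expnS expn1 leq_mul //; lia.
  by lia.
rewrite /repeat_pairs 2!size_cat 2!size_allpairs.
have h1 : size (inserts m n id) * size (ball n) <= 16 * K.
  by rewrite mulnC; apply: leq_trans hE; apply: leq_mul.
have h2 : size (ball n) * size (inserts m n id) <= 16 * K.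
  by rewrite mulnC.
have h3 : size (flatten [seq [seq (u, v) | v <- inserts m n (fun=> fword u)]
    | u <- ball n]) <= 16 * K.
  apply: leq_trans hE; apply: leq_trans (leq_mul hb (leqnn _)).
  by apply: size_flatten_le => u _; rewrite size_map.
have -> : 48 * K = 16 * K + (16 * K + 16 * K) by clear; lia.
by do 2?apply: leq_add.
Qed.

Lemma mem_inserts_occurs2 m n (u : F2) w w' : size u <= n -> size w = m ->
  (w' = w \/ w' = winv w) -> occurs [:: w; w'] u -> u \in inserts m n id.
Proof.
move=> un sw ww [s [t [uE [s' [t' [tE _]]]]]].
have E : fword u = (s ++ w ++ s') ++ w' ++ t' by rewrite uE tE -!catA.
have sw' : size w' = m by case: ww => ->; rewrite ?size_winv.
rewrite -(eltK u) E; apply: (@mem_inserts m n id _ w w' t' (size s)) => //.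
- by rewrite -E fword_reduced.
- by rewrite -E.
- by move: un; rewrite E !size_cat; lia.
by rewrite drop_size_cat // take_size_cat.
Qed.

Lemma mem_repeat_pairs m n (u v : F2) w : size u <= n -> size v <= n -> size w = m ->
  repeated w u v -> (u, v) \in repeat_pairs m n.
Proof.
move=> un vn sw [w' ww [r|r|[r r']]]; rewrite /repeat_pairs mem_cat; apply/orP.
- left; apply/allpairsP; exists (u, v); split=> //.
    exact: mem_inserts_occurs2 r.
  exact: mem_ball.
- right; rewrite mem_cat; apply/orP; left; apply/allpairsP; exists (u, v); split=> //.
    exact: mem_ball.
  exact: mem_inserts_occurs2 r.
right; rewrite mem_cat; apply/orP; right.
apply/flatten_mapP; exists u; first exact: mem_ball.
apply: map_f; case: r => s [t [uE _]]; case: r' => s' [t' [vE _]].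
rewrite -(eltK v) vE; apply: (@mem_inserts m n _ _ w w' t' (size s)) => //.
- by rewrite -vE fword_reduced.
- by rewrite -vE.
- by case: ww => ->; rewrite ?size_winv.
- by move: un; rewrite uE !size_cat; lia.
by rewrite uE drop_size_cat // take_size_cat.
Qed.

(** * Proper powers and exceptional pairs *)

Lemma cyclic_reduction s : reduced s -> exists p c,
  s = p ++ c ++ winv p /\ (c = [::] \/ reduced (c ++ c)).
Proof.
move: {2}(size s) (leqnn (size s)) => n; elim: n s => [|n IHn] s.
  by case: s => // _ _; exists [::], [::]; split; [|left].
case: s => [|x s]; first by move=> _ _; exists [::], [::]; split; [|left].
case/lastP: s => [|s y] le rs.
  exists [::], [:: x]; split=> //; right.
  by rewrite /reduced /= andbT eq_sym linv_neq.
have [yx|nyx] := eqVneq y (linv x).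
  have rs' : reduced s.
    by move: rs; rewrite -cat1s -cats1 => /reduced_catr/reduced_catl.
  have [|p [c [sE cP]]] := IHn s _ rs'.
    by move: le; rewrite /= size_rcons; lia.
  exists (x :: p), c; split=> //.
  by rewrite winv_cons sE yx /= !rcons_cat.
exists [::], (x :: rcons s y); split; first by rewrite cats0.
right; rewrite reduced_cat rs /junction /= -rcons_cons ohead_winv_rcons.
apply/eqP => -[e]; case/negP: nyx; apply/eqP.
by rewrite -e linvK.
Qed.

Lemma fword_expg (c : F2) k : reduced (c ++ c) -> fword (c ^+ k)%g = flatten (nseq k (fword c)).
Proof.
move=> rc; have [->|c1] := eqVneq c 1%g.
  by rewrite expg1n fword1; elim: k.
have -> : (c ^+ k)%g = (\prod_(x <- nseq k c) x)%g.
  by rewrite big_nseq; elim: k => // k IHk; rewrite expgS IHk.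
rewrite fword_prod ?map_nseq //; last by apply/allP => x; rewrite mem_nseq => /andP[_ /eqP ->].
have acc : adj c c.
  move: rc; rewrite reduced_cat => /and3P[_ _]; rewrite /junction /adj.
  by move: c1; rewrite fword_eq1 => /negbTE ->.
case: k => // k; rewrite /nseq /=; elim: k => //= k ->.
by rewrite acc.
Qed.

(** For [y] cyclically reduced the k-th power of x y x^-1, written without cancellation, has length
    2|x| + k|y|; as k >= 2, this gives |x| + |y| <= n/2. *)
Definition powers (n : nat) : seq F2 :=
  flatten [seq flatten [seq [seq ((x * y * x^-1) ^+ k)%g | x <- ball j, y <- ball (n./2 - j)]
    | k <- iota 0 n.+1] | j <- iota 0 (n./2).+1].

Lemma size_powers n : size (powers n) <= n.+1 * (n.+1 * (4 * 3 ^ n./2)).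
Proof.
apply: leq_trans (_ : (n./2).+1 * (n.+1 * (4 * 3 ^ n./2)) <= _); last first.
  by rewrite leq_mul //; lia.
rewrite -{1}(size_iota 0 (n./2).+1); apply: size_flatten_le => j.
rewrite mem_iota add0n ltnS leq0n andTb => jn.
rewrite -[X in X * (4 * _)](size_iota 0 n.+1); apply: size_flatten_le => k _.
rewrite size_allpairs; apply: leq_trans (leq_mul (size_ball _) (size_ball _)) _.
by rewrite mulnACA -expnD subnKC.
Qed.

Lemma mem_powers n (u : F2) : size u <= n -> proper_power u -> u \in powers n.
Proof.
move=> un [h [k [k1 uE]]]; rewrite uE in un *.
have [p [c [hE cP]]] := cyclic_reduction (fword_reduced h).
have hp : h = (elt p * elt c * (elt p)^-1)%g by rewrite -(eltK h) hE !elt_cat elt_winv mulgA.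
have rp : reduced p by have := fword_reduced h; rewrite hE => /reduced_catl.
have mem j k' (x y : F2) : j <= n./2 -> k' <= n -> size x <= j -> size y <= n./2 - j ->
    ((x * y * x^-1) ^+ k')%g \in powers n.
  move=> jn kn xj yj; apply/flatten_mapP; exists j; first by rewrite mem_iota.
  apply/flatten_mapP; exists k'; first by rewrite mem_iota.
  by apply/allpairsP; exists (x, y); split=> //; apply: mem_ball.
have [c0|c0] := eqVneq c [::].
  rewrite hp c0 elt_nil mulg1 mulgV expg1n.
  by have := mem 0 0 1%g 1%g; rewrite expg0; apply.
have rcc : reduced (c ++ c) by case: cP => // c0'; rewrite c0' in c0.
have rc : reduced c := reduced_catl rcc.
have cn0 : 0 < size c by case: (c) c0.
have kE : (h ^+ k)%g = (elt p * elt c ^+ k * (elt p)^-1)%g.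
  have -> : h = (elt c ^ (elt p)^-1)%g by rewrite conjgE invgK mulgA -hp.
  by rewrite -conjXg conjgE invgK mulgA.
have ckE : fword (elt c ^+ k)%g = flatten (nseq k c).
  by rewrite fword_expg fword_elt.
have sE : size (h ^+ k)%g = 2 * size p + k * size c.
  have -> : (h ^+ k)%g = elt (p ++ flatten (nseq k c) ++ winv p).
    by rewrite !elt_cat elt_winv kE -ckE eltK mulgA.
  rewrite fword_elt.
    rewrite !size_cat size_winv size_flatten /shape map_nseq sumn_nseq; lia.
  have := fword_reduced h; rewrite hE !reduced_cat reduced_winvE.
  case/and3P=> _ /and3P[_ _ jcp]; rewrite junction_catr // => jpc.
  have [k' kk] : exists k', k = k'.+1 by case: (k) k1 => // k' _; exists k'.
  rewrite rp -ckE fword_reduced ckE /=; apply/andP; split.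
    have -> : flatten (nseq k c) = flatten (nseq k' c) ++ c.
      by rewrite kk -addn1 nseqD flatten_cat /= cats0.
    by rewrite junction_catl.
  by rewrite kk /= -catA junction_catr.
rewrite hp; rewrite sE in un.
have le2 : 2 * size c <= k * size c by rewrite leq_mul.
have lek : k <= k * size c by rewrite leq_pmulr.
by apply: (mem (size p)); rewrite ?fword_elt //; lia.
Qed.

Definition coincidences (n : nat) : seq (F2 * F2) :=
  [seq (1%g, v) | v <- ball n] ++ [seq (u, 1%g) | u <- ball n] ++
  [seq (v, v) | v <- ball n] ++ [seq (v^-1, v)%g | v <- ball n].

Definition exceptions (n : nat) : seq (F2 * F2) :=
  [seq (u, v) | u <- powers n, v <- ball n] ++
  ([seq (u, v) | u <- ball n, v <- powers n] ++ coincidences n).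

Lemma size_exceptions n : size (exceptions n) <=
  16 * (n.+1 ^ 2 * 3 ^ (n + n./2)) + 8 * 3 ^ n.
Proof.
rewrite /exceptions 2!size_cat 2!size_allpairs.
have h : size (ball n) * size (powers n) <= 8 * (n.+1 ^ 2 * 3 ^ (n + n./2)).
  apply: leq_trans (leq_mul (size_ball n) (size_powers n)) _.
  rewrite expnD; move: (3 ^ n) (3 ^ n./2) => a b.
  by have -> : n.+1 ^ 2 = n.+1 * n.+1 by []; lia.
have h' : size (coincidences n) <= 8 * 3 ^ n.
  by rewrite /coincidences !size_cat !size_map; have := size_ball n; rewrite size_map; lia.
move: h h'; rewrite (mulnC (size (powers n))); lia.
Qed.

Lemma mem_exceptions n (u v : F2) : size u <= n -> size v <= n ->
  exceptional u v -> (u, v) \in exceptions n.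
Proof.
move=> un vn; have um := mem_ball un; have vm := mem_ball vn.
case=> [p|p|c]; rewrite /exceptions mem_cat; apply/orP.
- left; apply/allpairsP; exists (u, v); split=> //; exact: mem_powers.
- right; rewrite mem_cat; apply/orP; left.
  by apply/allpairsP; exists (u, v); split=> //; apply: mem_powers.
right; rewrite mem_cat; apply/orP; right; rewrite /coincidences.
case: c => [->|->|->|->]; rewrite mem_cat; apply/orP.
- by left; apply: (map_f (fun v => (1%g, v))).
- right; rewrite mem_cat; apply/orP; left.
  by apply: (map_f (fun u => (u, 1%g))).
- do 2![right; rewrite mem_cat; apply/orP]; left.
  by apply: (map_f (fun v => (v, v))).
do 2![right; rewrite mem_cat; apply/orP]; right.
by apply: (map_f (fun v => (v^-1, v)%g)).
Qed.

(** * Counting paths of bounded cost *)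

Fixpoint pathcost (c : letter -> letter -> nat) (z : letter) (w : seq letter) : nat :=
  if w is z' :: w' then c z z' + pathcost c z' w' else 0.

Definition light (c : letter -> letter -> nat) (N : nat) : seq (seq letter) :=
  flatten [seq flatten [seq [seq z :: w | w <- ext z k & pathcost c z w <= N]
    | k <- iota 0 N.+1] | z <- letters].

Lemma mem_light c N z w : reduced (z :: w) -> size w <= N ->
  pathcost c z w <= N -> z :: w \in light c N.
Proof.
move=> r sN cN; apply/flatten_mapP; exists z; first exact: mem_letters.
apply/flatten_mapP; exists (size w); first by rewrite mem_iota.
by apply: map_f; rewrite mem_filter cN mem_ext.
Qed.

Section Weights.
Variable R : realFieldType.
Local Open Scope ring_scope.

Lemma size_flatten_real (T : eqType) (U : Type) (F : T -> seq U) (s : seq T) (a K : R) :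
  (forall x, x \in s -> (size (F x))%:R * a <= K) ->
  (size (flatten [seq F x | x <- s]))%:R * a <= (size s)%:R * K.
Proof.
elim: s => [|x s IHs] le /=; first by rewrite !mul0r.
rewrite size_cat natrD mulrDl -[(size s).+1]add1n natrD mulrDl mul1r.
apply: lerD; first by apply: le; rewrite mem_head.
by apply: IHs => y ys; apply: le; rewrite inE ys orbT.
Qed.

Variables (c : letter -> letter -> nat) (mu : R) (h : letter -> R) (H : R).
Hypotheses (mu0 : 0 < mu) (mu1 : mu <= 1) (h1 : forall z, 1 <= h z)
  (hH : forall z, h z <= H).
Hypothesis super : forall z, \sum_(z' <- nexts z) mu ^+ c z z' * h z' <= h z.

(* [h] is a supersolution of the transfer operator, so the generating function
   of the costs stays below it. *)
Lemma ext_weight z k : \sum_(w <- ext z k) mu ^+ pathcost c z w <= h z.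
Proof.
elim: k z => [|k IHk] z /=; first by rewrite big_seq1 expr0.
apply: le_trans (super z); rewrite big_flatten big_map /=.
apply: ler_sum => y _; rewrite big_map /=.
rewrite (eq_bigr (fun w => mu ^+ c z y * mu ^+ pathcost c y w)); last first.
  by move=> w _; rewrite exprD.
by rewrite -mulr_sumr ler_wpM2l // exprn_ge0 // ltW.
Qed.

(** Markov's inequality: as [mu <= 1], each counted word contributes at least [mu ^+ N] to the
    generating function. *)
Lemma count_light z k N :
  (size [seq w <- ext z k | (pathcost c z w <= N)%N])%:R * mu ^+ N <= H.
Proof.
apply: le_trans (hH z); apply: le_trans (ext_weight z k).
elim: (ext z k) => [|w s IHs] /=; first by rewrite mul0r big_nil.
rewrite big_cons; case: ifP => [le|_] /=; last first.
  by rewrite -[X in X <= _]add0r lerD // exprn_ge0 // ltW.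
rewrite -add1n natrD mulrDl mul1r lerD //.
by apply: ler_wiXn2l => //; apply: ltW.
Qed.

Lemma size_light N : (size (light c N))%:R <= 4 * N.+1%:R * H * mu^-1 ^+ N.
Proof.
have le : (size (light c N))%:R * mu ^+ N <= (size letters)%:R * ((size (iota 0 N.+1))%:R * H).
  apply: size_flatten_real => z _; apply: size_flatten_real => k _.
  by rewrite size_map count_light.
rewrite size_iota mulrA in le.
by rewrite exprVn ler_pdivlMr ?exprn_gt0.
Qed.

End Weights.

Definition cost_bridge (s : letter -> bool) (z z' : letter) : nat :=
  1 + (s (linv z) != s z').

Definition cost_kind (i : bool) (z z' : letter) : nat :=
  if z'.1 == i then 2 else 1.

(** By balance, one of the three continuations starts at the vertex just reached and two need a
    crossing of [wr]: 1/2 + 1/4 + 1/4 = 1, so the constant function is an exact solution for [mu] =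
    1/2. *)
Lemma size_light_bridge (R : realFieldType) s N : balanced s ->
  ((size (light (cost_bridge s) N))%:R <= 4 * N.+1%:R * 2 ^+ N :> R)%R.
Proof.
move=> bs; rewrite -[X in (_ * X ^+ _)%R]invrK -[(4 * _)%R]mulr1.
apply: (@size_light R _ 2^-1 (fun=> 1%R)) => //; try lra.
move=> z; rewrite /cost_bridge; move: bs; rewrite /balanced.
case: z => [[] []]; rewrite /nexts /= !big_cons big_nil /=;
case: (s (false, false)); case: (s (false, true)); case: (s (true, false));
case: (s (true, true)) => //= _; lra.
Qed.

(** The growth rate is about 2.13, and 9/4 is a convenient rational bound; the weights 4 and 3
    approximate the eigenvector closely enough. *)
Lemma size_light_kind (R : realFieldType) i N :
  ((size (light (cost_kind i) N))%:R <= 4 * N.+1%:R * 4 * (9 / 4) ^+ N :> R)%R.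
Proof.
have -> : (9 / 4 = (4 / 9)^-1 :> R)%R by rewrite invfM invrK mulrC.
apply: (@size_light R _ (4 / 9) (fun z => if z.1 == i then 4%R else 3%R)) => //; try lra.
- by move=> z; case: ifP => _; lra.
- by move=> z; case: ifP => _; lra.
by move=> z; rewrite /cost_kind; case: z => [[] []]; case: i;
  rewrite /nexts /= !big_cons big_nil /=; lra.
Qed.

(** * Images of pairs of paths over all bounded graphs *)

Definition sides : seq {ffun letter -> bool} :=
  seq.filter (fun s : {ffun letter -> bool} => balanced s) (enum {: {ffun letter -> bool}}).

Lemma size_sides : size sides <= 16.
Proof.
rewrite size_filter; apply: leq_trans (count_size _ _) _.
by rewrite -cardT card_ffun !card_prod !card_bool.
Qed.

Definition images (c : letter -> letter -> nat) (N : nat) (S : lgraph) (g : F2) :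
    seq (F2 * F2) :=
  [seq ((mor S (elt U)) ^ g, (mor S (elt V)) ^ g)%g | U <- light c N, V <- light c N].

Definition bridge_images (k n : nat) : seq (F2 * F2) :=
  flatten [seq flatten [seq flatten [seq flatten [seq flatten [seq
    images (cost_bridge s) n (LGraph a b r s) g
  | g <- ball k] | r <- ball k] | b <- ball k] | a <- ball k] | s : {ffun _} <- sides].

Definition wedge_images (k n : nat) : seq (F2 * F2) :=
  flatten [seq flatten [seq flatten [seq flatten [seq flatten [seq
    images (cost_kind i) n.+2 (LGraph a b 1%g s) g
  | g <- ball k] | i <- [:: false; true]] | b <- ball k] | a <- ball k] | s : {ffun _} <- sides].

Lemma size_images (R : realFieldType) c N S g (L : R) :
  ((size (light c N))%:R <= L)%R -> ((size (images c N S g))%:R <= L ^+ 2)%R.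
Proof.
move=> le; rewrite size_allpairs natrM expr2.
by apply: ler_pM => //; apply: ler0n.
Qed.

Lemma size_ball_real (R : realFieldType) k (K : R) (T : Type) (F : F2 -> seq T) :
  (forall x, (size (F x))%:R <= K)%R ->
  ((size (flatten [seq F x | x <- ball k]))%:R <= 2 * 3 ^+ k * K)%R.
Proof.
move=> le; have := @size_flatten_real R _ _ F (ball k) 1 K.
rewrite mulr1 => h; apply: le_trans (h _) _; first by move=> x _; rewrite mulr1.
apply: ler_wpM2r; first by apply: le_trans (le 1%g); apply: ler0n.
by have := size_ball k; rewrite -(ler_nat R) natrM natrX.
Qed.

Lemma size_sides_real (R : realFieldType) (K : R) (T : Type) (F : {ffun letter -> bool} -> seq T) :
  (0 <= K)%R -> (forall s : {ffun letter -> bool}, balanced s -> (size (F s))%:R <= K)%R ->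
  ((size (flatten [seq F x | x <- sides]))%:R <= 16 * K)%R.
Proof.
move=> K0 le; have := @size_flatten_real R _ _ F sides 1 K.
rewrite mulr1 => h; apply: le_trans (h _) _.
  by move=> x; rewrite mem_filter mulr1 => /andP[/le].
by apply: ler_wpM2r => //; have := size_sides; rewrite -(ler_nat R).
Qed.

Lemma size_bridge_images (R : realFieldType) k n :
  ((size (bridge_images k n))%:R <=
    16 * ((2 * 3 ^+ k) ^+ 4 * (4 * n.+1%:R * 2 ^+ n) ^+ 2) :> R)%R.
Proof.
rewrite /bridge_images; apply: size_sides_real => [|s bs].
  by rewrite mulr_ge0 // exprn_ge0 // ?mulr_ge0 ?exprn_ge0 ?ler0n.
set B := (2 * 3 ^+ k)%R; set L := (4 * _ * _)%R.
have -> : (B ^+ 4 * L ^+ 2 = B * (B * (B * (B * L ^+ 2))))%R by ring.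
do 4!apply: size_ball_real => ?.
exact: size_images (size_light_bridge R n bs).
Qed.

Lemma size_wedge_images (R : realFieldType) k n :
  ((size (wedge_images k n))%:R <=
    16 * (2 * (2 * 3 ^+ k) ^+ 3 * (4 * n.+3%:R * 4 * (9 / 4) ^+ n.+2) ^+ 2) :> R)%R.
Proof.
have L0 : (0 <= 4 * n.+3%:R * 4 * (9 / 4) ^+ n.+2 :> R)%R.
  have p : (0 <= 9 / 4 :> R)%R by lra.
  by apply: mulr_ge0; [rewrite !mulr_ge0 ?ler0n|apply: exprn_ge0].
rewrite /wedge_images; apply: size_sides_real => [|s bs].
  by apply: mulr_ge0; rewrite ?exprn_ge0 // mulr_ge0 // exprn_ge0 // mulr_ge0 // exprn_ge0.
set B := (2 * 3 ^+ k)%R; move: L0; set L := (4 * _ * 4 * _)%R => L0.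
have -> : (2 * B ^+ 3 * L ^+ 2 = B * (B * (2 * (B * L ^+ 2))))%R by ring.
do 2!apply: size_ball_real => ?.
rewrite -[leLHS]mulr1; apply: (@size_flatten_real R _ _ _ [:: false; true]) => i _.
rewrite mulr1; apply: size_ball_real => ?.
exact: size_images (size_light_kind R i n.+2).
Qed.

Lemma mem_images c N S g U V : U \in light c N -> V \in light c N ->
  ((mor S (elt U)) ^ g, (mor S (elt V)) ^ g)%g \in images c N S g.
Proof. by move=> UL VL; apply/allpairsP; exists (U, V). Qed.

Lemma mem_sides (s : {ffun letter -> bool}) : balanced s -> s \in sides.
Proof. by move=> bs; rewrite mem_filter bs mem_enum. Qed.

Lemma pathcost_bridge S z w : wr S != 1%g ->
  pathcost (cost_bridge (sd S)) z w <= size (walk S (sd S (linv z)) w).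
Proof.
move=> w1; elim: w z => //= z' w IHw z; have := IHw z'.
by rewrite size_cat /= /cost_bridge /bridge (negbTE w1) orbF; case: eqVneq => _ /=; lia.
Qed.

Lemma size_pathcost_bridge s z w : size w <= pathcost (cost_bridge s) z w.
Proof. by elim: w z => //= z' w IHw z; have := IHw z'; rewrite /cost_bridge; lia. Qed.

Lemma size_pathcost_kind i z w : size w <= pathcost (cost_kind i) z w.
Proof.
by elim: w z => //= z' w IHw z; have := IHw z'; rewrite /cost_kind; case: ifP => _; lia.
Qed.

Lemma light_bridge S g U n : good S g -> wr S != 1%g -> reduced U -> U != [::] ->
  size ((mor S (elt U)) ^ g)%g <= n -> U \in light (cost_bridge (sd S)) n.
Proof.
move=> gd w1 rU U0 un; have := leq_trans (size_walk gd rU U0) un.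
case: U rU U0 {un} => // z w rU _ /=; rewrite size_cat /= => sw.
have c := pathcost_bridge z w w1; have sc := size_pathcost_bridge (sd S) z w.
by apply: mem_light => //; lia.
Qed.

Lemma walk_wedge S p U : wr S = 1%g -> walk S p U = map inl U.
Proof.
by move=> w1; elim: U p => [|z U IHU] p /=; rewrite /bridge w1 eqxx orbT //= IHU.
Qed.

Lemma pathcost_rcons c z w y :
  pathcost c z (rcons w y) = pathcost c z w + c (last z w) y.
Proof. by elim: w z => [|x w IHw] z /=; rewrite ?addn0 // IHw addnA. Qed.

(** Full labels are available only strictly between the first and the last edge. The first is not
    charged by [pathcost] and the last costs at most 2, whence the budget n + 2. *)
Lemma light_wedge S g U n i : good S g -> wr S = 1%g -> 1 < size (edge S (i, false)) ->
  reduced U -> U != [::] ->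
  size ((mor S (elt U)) ^ g)%g <= n -> U \in light (cost_kind i) n.+2.
Proof.
move=> gd w1 ie rU U0 un; case: U rU U0 un => // z w rU U0 un.
suff c : pathcost (cost_kind i) z w <= n.+2.
  by apply: mem_light => //; apply: leq_trans c; apply: size_pathcost_kind.
case/lastP: w rU U0 un => // w y rU U0 un.
pose K := \max_(x : letter) cut S g (inl x) + \max_q cut S g (inr q).
have cK e : cut S g e <= K.
  rewrite /K; case: e => x.
    by apply: leq_trans (leq_addr _ _); apply: (leq_bigmax x).
  by apply: leq_trans (leq_addl _ _); apply: (leq_bigmax x).
have E : walk S false (z :: rcons w y) = inl z :: rcons (map inl w) (inl y).
  by rewrite walk_wedge //= map_rcons.
have := leq_trans (occurs_size (occurs_mid gd rU U0 cK E)) un; rewrite -!map_comp => sw.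
rewrite pathcost_rcons; have : cost_kind i (last z w) y <= 2 by rewrite /cost_kind; case: ifP.
suff : pathcost (cost_kind i) z w <= sumn [seq size (edge S x) | x <- w].
  by move: sw; rewrite /comp /=; lia.
elim: w {sw E rU U0 un} z => //= x w IHw z; apply: leq_add => //.
rewrite /cost_kind; case: eqP => [xi|_]; last by rewrite size_fword_gt0 (good_edge gd).
have [<- //|ne] := eqVneq (i, false) x.
by rewrite (linv_eqV ne) ?size_edgeV.
Qed.

(** * Estimates *)

(** Repetitions are listed at length exactly m + 1, since a longer repeated word contains a repeated
    one of that length. *)
Definition nonprime_cover (n : nat) : seq (F2 * F2) :=
  repeat_pairs (n %/ 14).+1 n ++ (exceptions n ++
  (bridge_images (2 * (n %/ 14)) n ++ wedge_images (2 * (n %/ 14)) n)).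

Lemma mem_catl (T : eqType) (s t : seq T) x : x \in s -> x \in s ++ t.
Proof. by rewrite mem_cat => ->. Qed.

Lemma mem_catr (T : eqType) (s t : seq T) x : x \in t -> x \in s ++ t.
Proof. by rewrite mem_cat => ->; rewrite orbT. Qed.

Lemma mem_nonprime_cover n (u v : F2) : size u <= n -> size v <= n ->
  ~ prime_endo (phi u v) -> (u, v) \in nonprime_cover n.
Proof.
move=> un vn np; set m := n %/ 14.
have [nr|rep] := pselect (no_repeat m u v); last first.
  move/existsNP: rep => [w /not_implyP[rw /negP]]; rewrite -ltnNge => lt.
  have [w0 sw0 rw0] := repeated_take lt rw.
  by apply: mem_catl; apply: mem_repeat_pairs rw0.
apply: mem_catr; have [ex|nex] := pselect (exceptional u v).
  by apply: mem_catl; apply: mem_exceptions.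
apply: mem_catr; have [S [g [U [V [[gd notbasis] [rU rV U0 V0] [uE vE] [ba bb br bg]]]]]] :=
  nonprime_structure nr nex np.
have SE : S = LGraph (wa S) (wb S) (wr S) (sd S) by case: (S).
have bs := mem_sides (good_bal gd).
rewrite uE vE; rewrite uE in un; rewrite vE in vn.
have [w1|w1] := eqVneq (wr S) 1%g; last first.
  apply: mem_catl; apply/flatten_mapP; exists (sd S) => //.
  apply/flatten_mapP; exists (wa S); first exact: mem_ball.
  apply/flatten_mapP; exists (wb S); first exact: mem_ball.
  apply/flatten_mapP; exists (wr S); first exact: mem_ball.
  apply/flatten_mapP; exists g; first exact: mem_ball.
  by rewrite -SE; apply: mem_images;
    [exact: light_bridge gd w1 rU U0 un|exact: light_bridge gd w1 rV V0 vn].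
have [i ie] : exists i, 1 < size (edge S (i, false)).
  apply: contrapT => H; apply: notbasis; split=> //.
  have e i : size (edge S (i, false)) = 1.
    apply/eqP; rewrite eqn_leq size_fword_gt0 (good_edge gd) andbT leqNgt.
    by apply/negP => lt; apply: H; exists i.
  by split; [apply: (e false)|apply: (e true)].
apply: mem_catr; apply/flatten_mapP; exists (sd S) => //.
apply/flatten_mapP; exists (wa S); first exact: mem_ball.
apply/flatten_mapP; exists (wb S); first exact: mem_ball.
apply/flatten_mapP; exists i; first by case: (i).
apply/flatten_mapP; exists g; first exact: mem_ball.
by rewrite -w1 -SE; apply: mem_images;
  [exact: light_wedge gd w1 ie rU U0 un|exact: light_wedge gd w1 ie rV V0 vn].
Qed.

Lemma cardF_le (T : choiceType) (A : set T) (s : seq T) :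
  (forall x, A x -> x \in s) -> cardF A <= size s.
Proof.
move=> As; have fA : finite_set A.
  by apply: (@sub_finite_set _ _ [set x | x \in s]); [|exact: finite_seq].
rewrite /cardF; apply: uniq_leq_size; first exact: fset_uniq.
by move=> x; rewrite in_fset_set // => /set_mem/As.
Qed.

Lemma cardF_ge (T : choiceType) (A : set T) (s : seq T) : finite_set A ->
  uniq s -> (forall x, x \in s -> A x) -> size s <= cardF A.
Proof.
move=> fA us sA; rewrite /cardF; apply: uniq_leq_size => // x xs.
by rewrite in_fset_set // inE; apply: sA.
Qed.

(** The words of length [n] that can follow a fixed letter already number 3^n. *)
Lemma card_wball_pair_ge n : 3 ^ (2 * n) <= cardF (wball n `*` wball n)%classic.
Proof.
pose z : letter := (false, false).
have uw : uniq (map elt (ext z n)).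
  rewrite map_inj_in_uniq ?uniq_ext // => s t sz tz e.
  have r w : w \in ext z n -> reduced w.
    by move=> wz; move: (wz); rewrite -(ext_size wz) mem_ext => /(@reduced_catr [:: z]).
  by rewrite -(fword_elt (r _ sz)) -(fword_elt (r _ tz)) e.
have := @cardF_ge _ _ [seq (x, y) | x <- map elt (ext z n), y <- map elt (ext z n)]
  (finite_wball_pair n).
rewrite size_allpairs size_map size_ext -expnD addnn -mul2n; apply.
  by apply: allpairs_uniq => // -[a b] [c d] _ _ [-> ->].
have b x : x \in map elt (ext z n) -> wball n x.
  case/mapP => w wz ->; rewrite /wball /=.
  have rw : reduced w.
    by move: (wz); rewrite -(ext_size wz) mem_ext => /(@reduced_catr [:: z]).
  by rewrite -[reduce w]/(fword (elt w)) fword_elt // (ext_size wz).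
by move=> x /allpairsP[p [p1 p2 ->]]; split; apply: b.
Qed.

Lemma card_Nnp_le n : cardF (Nnp n) <= size (nonprime_cover n).
Proof. by apply: cardF_le => -[u v] [[/= un vn] np]; apply: mem_nonprime_cover. Qed.

Section Estimates.
Variable R : realType.
Local Open Scope ring_scope.

Lemma scale_le (C a b x y : R) : 0 <= C -> 0 <= a -> 0 <= x -> a <= b -> x <= y ->
  C * (a * x) <= C * (b * y).
Proof. by move=> C0 a0 x0 ab xy; apply: ler_wpM2l => //; apply: ler_pM. Qed.

Definition cover_const : R := 192 + (72 + (2 ^+ 14 + 2 ^+ 12 * 3 ^+ 8)).

(** [Y] stands for 3^(n/14). Only its integer powers and the enclosure between 3^m and 3^(m+1) are
    used, which takes care of the rounding in m. *)
Lemma cover_bound (n : nat) (Y : R) : (1 <= n)%N -> 1 <= Y -> Y ^+ 14 = 3 ^+ n ->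
  3 ^+ (n %/ 14) <= Y -> Y <= 3 ^+ (n %/ 14).+1 ->
  (size (nonprime_cover n))%:R <= cover_const * (n%:R ^+ 2 * Y ^+ 27).
Proof.
move=> n1 Y1 Y14 Ylo Yhi.
have Y0 : 0 <= Y by lra.
have n1R : (1 <= n%:R :> R) by rewrite ler1n.
have Ymono i j : (i <= j)%N -> Y ^+ i <= Y ^+ j by move=> ij; apply: ler_weXn2l.
set m := (n %/ 14)%N in Ylo Yhi *.
have mn : (m.+1 <= n)%N by rewrite /m; lia.
have m0 k : 0 <= 3 ^+ k :> R by apply: exprn_ge0.
have h2 : (n.+1%:R : R) ^+ 2 <= 4 * n%:R ^+ 2 by rewrite -natr1; nra.
have h3 : (n.+3%:R : R) ^+ 2 <= 16 * n%:R ^+ 2.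
  by rewrite -addn3 natrD; nra.
have rep : (size (repeat_pairs m.+1 n))%:R <= 192 * (n%:R ^+ 2 * Y ^+ 27) :> R.
  have := size_repeat_pairs mn; rewrite -(ler_nat R) !natrM !natrX => h.
  apply: le_trans h _.
  (* A repetition saves 3^(m+1) >= Y against 3^(2n) = Y^28. *)
  have h4 : 3 ^+ (n + (n - m.+1)) <= Y ^+ 27.
    have p3 : 0 < 3 ^+ m.+1 :> R by apply: exprn_gt0.
    rewrite -(ler_pM2r p3) -exprD.
    have -> : (n + (n - m.+1) + m.+1 = n + n)%N by lia.
    rewrite exprD -Y14 -exprD -[(14 + 14)%N]/(27 + 1)%N exprD expr1.
    by rewrite ler_pM2l // exprn_gt0 //; lra.
  have -> : 192 * (n%:R ^+ 2 * Y ^+ 27) = 48 * (4 * n%:R ^+ 2 * Y ^+ 27) by ring.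
  by rewrite -[leLHS]mulrA; apply: scale_le => //; apply: sqr_ge0.
have exc : (size (exceptions n))%:R <= 72 * (n%:R ^+ 2 * Y ^+ 27) :> R.
  have := size_exceptions n; rewrite -(ler_nat R) natrD !natrM !natrX => h.
  apply: le_trans h _.
  have h4 : 3 ^+ (n + n./2) <= Y ^+ 27.
    have h5 : 3 ^+ n./2 <= Y ^+ 7.
      rewrite -ler_sqr ?nnegrE ?exprn_ge0 // -!exprM Y14 ler_weXn2l //; last by lia.
      by lra.
    rewrite exprD -Y14; apply: le_trans (Ymono 21%N 27%N _) => //.
    by rewrite -[21%N]/(14 + 7)%N exprD ler_wpM2l // exprn_ge0.
  have h5 : 3 ^+ n <= n%:R ^+ 2 * Y ^+ 27.
    rewrite -Y14; apply: le_trans (Ymono 14%N 27%N _) _ => //.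
    by rewrite ler_peMl ?exprn_ge0 // exprn_ege1.
  have -> : 72 * (n%:R ^+ 2 * Y ^+ 27) =
      16 * (4 * n%:R ^+ 2 * Y ^+ 27) + 8 * (n%:R ^+ 2 * Y ^+ 27) by ring.
  apply: lerD; last by apply: ler_wpM2l.
  by apply: scale_le => //; apply: sqr_ge0.
have a23 : (2 : R) ^+ n <= 3 ^+ n by apply: lerXn2r => //; rewrite ?nnegrE //; lra.
have bri : (size (bridge_images (2 * m) n))%:R <= 2 ^+ 14 * (n%:R ^+ 2 * Y ^+ 27) :> R.
  apply: le_trans (size_bridge_images R (2 * m) n) _.
  (* After taking 14th powers this is 2^28 <= 3^19 raised to the n, obtained from nine factors 2^3
     <= 3^2 and one factor 2 <= 3. *)
  have h4 : (2 ^+ n) ^+ 2 <= Y ^+ 19.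
    rewrite -(@ler_pXn2r _ 14) ?nnegrE ?exprn_ge0 //.
    have -> : (Y ^+ 19) ^+ 14 = (3 ^+ n) ^+ 19 by rewrite -Y14 -!exprM.
    have e1 : ((2 : R) ^+ n) ^+ 3 <= (3 ^+ n) ^+ 2.
      by rewrite -!exprM mulnC (mulnC n) !exprM; apply: lerXn2r; rewrite ?nnegrE; lra.
    have -> : (((2 : R) ^+ n) ^+ 2) ^+ 14 = (((2 ^+ n) ^+ 3) ^+ 9) * 2 ^+ n.
      by rewrite -!exprM -exprD; congr (_ ^+ _); lia.
    have -> : ((3 : R) ^+ n) ^+ 19 = ((3 ^+ n) ^+ 2) ^+ 9 * 3 ^+ n.
      by rewrite -!exprM -exprD; congr (_ ^+ _); lia.
    apply: ler_pM => //; rewrite ?exprn_ge0 //.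
    by apply: lerXn2r; rewrite ?nnegrE ?exprn_ge0.
  have h5 : (3 ^+ m) ^+ 8 <= Y ^+ 8 by apply: lerXn2r; rewrite ?nnegrE.
  have -> : 16 * ((2 * 3 ^+ (2 * m)) ^+ 4 * (4 * n.+1%:R * 2 ^+ n) ^+ 2) =
     2 ^+ 12 * (n.+1%:R ^+ 2 * ((3 ^+ m) ^+ 8 * (2 ^+ n) ^+ 2)) :> R.
    by rewrite mulnC exprM; ring.
  have -> : 2 ^+ 14 * (n%:R ^+ 2 * Y ^+ 27) =
      2 ^+ 12 * (4 * n%:R ^+ 2 * (Y ^+ 8 * Y ^+ 19)) by ring.
  apply: scale_le => //; rewrite ?exprn_ge0 ?mulr_ge0 ?exprn_ge0 //.
  by apply: ler_pM; rewrite ?exprn_ge0.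
have wed : (size (wedge_images (2 * m) n))%:R <= 2 ^+ 12 * 3 ^+ 8 * (n%:R ^+ 2 * Y ^+ 27) :> R.
  apply: le_trans (size_wedge_images R (2 * m) n) _.
  have p9 : 0 <= 9 / 4 :> R by lra.
  (* Squaring reduces this to (9/4)^4 = 6561/256 <= 27 = 3^3. *)
  have h4 : ((9 / 4) ^+ n) ^+ 2 <= Y ^+ 21.
    rewrite -ler_sqr ?nnegrE ?exprn_ge0 //.
    have -> : (Y ^+ 21) ^+ 2 = (3 ^+ 3) ^+ n.
      by rewrite -exprM -[(21 * 2)%N]/(14 * 3)%N exprM Y14 -!exprM mulnC.
    have -> : (((9 / 4) ^+ n) ^+ 2) ^+ 2 = ((9 / 4) ^+ 4) ^+ n :> R.
      by rewrite [RHS]exprAC; ring.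
    by apply: lerXn2r; rewrite ?nnegrE ?exprn_ge0 //; lra.
  have h5 : (3 ^+ m) ^+ 6 <= Y ^+ 6 by apply: lerXn2r; rewrite ?nnegrE.
  have -> : 16 * (2 * (2 * 3 ^+ (2 * m)) ^+ 3 * (4 * n.+3%:R * 4 * (9 / 4) ^+ n.+2) ^+ 2) =
     2 ^+ 8 * 3 ^+ 8 * (n.+3%:R ^+ 2 * ((3 ^+ m) ^+ 6 * ((9 / 4) ^+ n) ^+ 2)) :> R.
    by rewrite mulnC exprM !exprS; field.
  have -> : 2 ^+ 12 * 3 ^+ 8 * (n%:R ^+ 2 * Y ^+ 27) =
      2 ^+ 8 * 3 ^+ 8 * (16 * n%:R ^+ 2 * (Y ^+ 6 * Y ^+ 21)) by ring.
  apply: scale_le => //; rewrite ?exprn_ge0 ?mulr_ge0 ?exprn_ge0 //.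
  by apply: ler_pM; rewrite ?exprn_ge0.
rewrite /nonprime_cover (size_cat (repeat_pairs _ _)) (size_cat (exceptions _)).
rewrite (size_cat (bridge_images _ _)) 3!natrD.
move: rep exc bri wed; set Z := (n%:R ^+ 2 * _) => rep exc bri wed.
have -> : cover_const * Z = 192 * Z + (72 * Z + (2 ^+ 14 * Z + 2 ^+ 12 * 3 ^+ 8 * Z)).
  by rewrite /cover_const; ring.
exact: lerD rep (lerD exc (lerD bri wed)).
Qed.
End Estimates.

(** * The probability bound and the upper limit *)

Section Limit.
Variable R : realType.
Local Open Scope ring_scope.

Let Y (n : nat) : R := 3 `^ (n%:R / 14).

Lemma cardF_Nnp_le n : (1 <= n)%N ->
  (cardF (Nnp n))%:R <= cover_const R * (n%:R ^+ 2 * Y n ^+ 27) :> R.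
Proof.
move=> n1; have le := card_Nnp_le n; rewrite -(ler_nat R) in le.
apply: le_trans le _; apply: cover_bound => //.
- rewrite -(powRr0 3); apply: ler_powR; first lra.
  by rewrite divr_ge0.
- rewrite -powR_mulrn ?powR_ge0 // -powRrM -powR_mulrn //.
  by congr (_ `^ _); field.
- rewrite -powR_mulrn //; apply: ler_powR; first lra.
  by rewrite ler_pdivlMr // -natrM ler_nat leq_divM.
rewrite -powR_mulrn //; apply: ler_powR; first lra.
rewrite ler_pdivrMr // -natrM ler_nat.
by have := ltn_ceil n (isT : (0 < 14)%N) => /ltnW.
Qed.

Lemma Y_gt0 n : 0 < Y n. Proof. by rewrite powR_gt0. Qed.

Lemma Y28 n : Y n ^+ 28 = 3 ^+ (2 * n).
Proof.
rewrite -powR_mulrn ?powR_ge0 // -powRrM -powR_mulrn //.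
by congr (_ `^ _); rewrite natrM; field.
Qed.

Lemma cover_const_ge1 : 1 <= cover_const R.
Proof.
have p : 0 <= 2 ^+ 14 + 2 ^+ 12 * 3 ^+ 8 :> R.
  by apply: addr_ge0; rewrite ?mulr_ge0 ?exprn_ge0.
rewrite /cover_const; apply: le_trans (_ : 192 <= _); first lra.
by rewrite lerDl; apply: addr_ge0.
Qed.

Lemma nonprime_probability n : (1 <= n)%N ->
  unif_prob R (wball n `*` wball n)%classic
    [set p : F2 * F2 | ~ prime_endo (phi p.1 p.2)]%classic
  <= cover_const R * n%:R `^ 2 * 3 `^ (- (n%:R / 14)).
Proof.
move=> n1; rewrite /unif_prob.
have := card_wball_pair_ge n; rewrite -(ler_nat R) natrX -Y28 => hb.
have y0 := Y_gt0 n.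
have b0 : 0 < (cardF (wball n `*` wball n)%classic)%:R :> R.
  by apply: lt_le_trans hb; apply: exprn_gt0.
rewrite ler_pdivrMr //; apply: le_trans (cardF_Nnp_le n1) _.
rewrite powRN -[_ `^ (_ / _)]/(Y n) -[2]/(2%:R) (@powR_mulrn _ n%:R 2) ?ler0n //.
rewrite -[leRHS]mulrA -[leRHS]mulrA.
apply: ler_wpM2l; first by have := cover_const_ge1; lra.
apply: ler_wpM2l; first exact: sqr_ge0.
by rewrite ler_pdivlMl // -exprS.
Qed.

(** A crude bound suffices: the polynomial factor only has to contribute o(n) to the logarithm. *)
Lemma ln_nat_le (n : nat) : (1 <= n)%N -> ln n%:R <= 2 * Num.sqrt n%:R :> R.
Proof.
move=> n1; have n0 : 0 < n%:R :> R by rewrite ltr0n.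
have s0 : 0 < Num.sqrt n%:R :> R by rewrite sqrtr_gt0.
rewrite -{1}(sqr_sqrtr (ltW n0)) lnXn // -[leLHS]mulr_natl.
by apply: ler_wpM2l => //; apply/ltW/ln_sublinear.
Qed.

Lemma log_ratio_le (n : nat) : (1 <= n)%N ->
  ln (cardF (Nnp n))%:R / ln (cardF (wball n `*` wball n)%classic)%:R
  <= 27 / 28 + (ln (cover_const R) + 4) / (2 * ln 3) / Num.sqrt n%:R :> R.
Proof.
move=> n1; have n0 : 0 < n%:R :> R by rewrite ltr0n.
have s0 : 0 < Num.sqrt n%:R :> R by rewrite sqrtr_gt0.
have s1 : 1 <= Num.sqrt n%:R :> R by rewrite -[leLHS]sqrtr1; apply: ler_wsqrtr; rewrite ler1n.
have sE : Num.sqrt n%:R ^+ 2 = n%:R :> R by rewrite sqr_sqrtr // ltW.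
have l3 : 0 < ln 3 :> R by rewrite ln_gt0 //; lra.
have C1 := cover_const_ge1; have lC : 0 <= ln (cover_const R) by apply: ln_ge0.
have y0 := Y_gt0 n.
have hb : 2 * n%:R * ln 3 <= ln (cardF (wball n `*` wball n)%classic)%:R :> R.
  have := card_wball_pair_ge n; rewrite -(ler_nat R) natrX => h.
  have p3 : 0 < 3 ^+ (2 * n) :> R by apply: exprn_gt0.
  rewrite -natrM mulr_natl -lnXn // ler_ln ?posrE //.
  exact: lt_le_trans p3 h.
have d0 : 0 < 2 * n%:R * ln 3 :> R by rewrite !mulr_gt0.
set a := ln (cardF (Nnp n))%:R; set b := ln (cardF (wball n `*` wball n)%classic)%:R in hb *.
have ha : a <= ln (cover_const R) + 4 * Num.sqrt n%:R + 27 / 14 * n%:R * ln 3.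
  have lnn := ln_nat_le n1; have := cardF_Nnp_le n1; rewrite /a.
  (* For an empty set [ln 0] is 0 by convention, and the right-hand side is nonnegative. *)
  have [->|k0] := posnP (cardF (Nnp n)).
    move=> _; rewrite ln0 //; apply: addr_ge0.
      by apply: addr_ge0 => //; rewrite mulr_ge0 // ltW.
    by rewrite !mulr_ge0 // ltW.
  rewrite -ler_ln ?posrE ?ltr0n ?mulr_gt0 ?exprn_gt0 //; last by lra.
  rewrite lnM ?posrE ?mulr_gt0 ?exprn_gt0 //; last by lra.
  rewrite lnM ?posrE ?exprn_gt0 // !lnXn // /Y ln_powR -(mulr_natl _ 2) -(mulr_natl _ 27) => h.
  apply: le_trans h _; lra.
have r0 : 0 <= ln (cover_const R) + 4 * Num.sqrt n%:R + 27 / 14 * n%:R * ln 3.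
  by apply: addr_ge0; [apply: addr_ge0 => //; rewrite mulr_ge0 // ltW|rewrite !mulr_ge0 // ltW].
have b0 : 0 < b := lt_le_trans d0 hb.
set r := (_ + _ + _) in ha r0; rewrite ler_pdivrMr //; apply: le_trans ha _.
apply: le_trans (_ : r / (2 * n%:R * ln 3) * b <= _).
  rewrite mulrAC ler_pdivlMr //; exact: ler_wpM2l.
apply: ler_wpM2r; first exact: ltW.
rewrite ler_pdivrMr // /r; set s := Num.sqrt n%:R in sE s0 s1 *; rewrite -sE.
set k := ln (cover_const R) in lC *; set t := ln 3 in l3 *.
have -> : (27 / 28 + (k + 4) / (2 * t) / s) * (2 * s ^+ 2 * t) = 27 / 14 * s ^+ 2 * t + (k + 4) * s.
  by field; apply/andP; split; apply: lt0r_neq0.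
have : k <= k * s by rewrite ler_peMr.
by lra.
Qed.

Lemma delta_np_le : (delta_np R <= (27 / 28)%:E)%E.
Proof.
apply/lee_addgt0Pr => e e0.
pose D : R := (ln (cover_const R) + 4) / (2 * ln 3) / e.
have l3 : 0 < ln 3 :> R by rewrite ln_gt0 //; lra.
have lC : 0 <= ln (cover_const R) by apply: ln_ge0; exact: cover_const_ge1.
have D0 : 0 <= D by rewrite /D !divr_ge0 ?mulr_ge0 ?addr_ge0 // ltW.
(* For n >= D^2 the error term [D * e / Num.sqrt n%:R] is at most [e]. *)
pose N := (Num.bound (D ^+ 2)).+1.
have hN n : (N <= n)%N -> ln (cardF (Nnp n))%:R /
    ln (cardF (wball n `*` wball n)%classic)%:R <= 27 / 28 + e :> R.
  move=> Nn; have n1 : (1 <= n)%N by apply: leq_trans Nn.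
  apply: le_trans (log_ratio_le n1) _; apply: lerD => //.
  have s0 : 0 < Num.sqrt n%:R :> R by rewrite sqrtr_gt0 ltr0n.
  rewrite ler_pdivrMr // -ler_pdivrMl // mulrC -/D.
  have -> : D = Num.sqrt (D ^+ 2) by rewrite sqrtr_sqr ger0_norm.
  apply: ler_wsqrtr; apply: le_trans (ltW (archi_boundP (sqr_ge0 D))) _.
  by rewrite ler_nat ltnW.
rewrite /delta_np /limn_esup limf_esupE; apply: ge_ereal_inf.
eexists; first by exists [set n | (N <= n)%N]%classic; [exists N|].
apply: ge_ereal_sup => _ [n Nn <-].
by rewrite -EFinD lee_fin; apply: hN.
Qed.
End Limit.

Local Open Scope ring_scope.
Local Open Scope classical_set_scope.

Theorem theoremA (R : realType) :
  (exists A B : R, [/\ 0 < A, 0 < B &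
     forall n : nat, (1 <= n)%N ->
       unif_prob R (wball n `*` wball n)
         [set p : F2 * F2 | ~ prime_endo (phi p.1 p.2)]
         <= A * n%:R `^ B * 3 `^ (- (n%:R / 14))])
  /\ (delta_np R <= (27 / 28)%:E)%E.
Proof.
split; last exact: delta_np_le.
exists (cover_const R), 2; split=> //; last exact: nonprime_probability.
exact: lt_le_trans (cover_const_ge1 R).
Qed.
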